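(* Let $A$ be any non-universal ceer. Then there is a sequence $(E_l)_{l\in\omega}$ of pairwise incomparable (under $\leq$) hereditarily self-full ceers such that for every $n,l\in\omega$, $A\oplus \mathrm{Id}_n\leq E_l$, and for every ceer $X$, if $X<E_l$ then there exists $k\in\omega$ with $X\leq A\oplus\mathrm{Id}_k$.
   Context: A ceer is a computably enumerable equivalence relation on $\omega$. For equivalence relations $R,S$, $R\leq S$ if there is a total computable $f$ with $x\,R\,y\Leftrightarrow f(x)\,S\,f(y)$; $R<S$ means $R\leq S$ and $S\not\leq R$. A ceer is universal if every ceer is reducible to it. The uniform join is $R\oplus S=\{(2x,2y):(x,y)\in R\}\cup\{(2x+1,2y+1):(x,y)\in S\}$. For $k\geq1$, $\mathrm{Id}_k$ denotes a ceer with exactly $k$ classes, and $A\oplus\mathrm{Id}_0$ denotes $A$. A ceer $R$ is self-full if every computable reduction of $R$ to $R$ has range intersecting every $R$-class. A ceer $X$ is hereditarily self-full if $X\oplus Y$ is self-full for every self-full ceer $Y$. *)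

(* Defs.v *)
From Stdlib Require Import Arith List Relations.
Import ListNotations.

(** Codes for the partial recursive functions on tuples of natural numbers.
    The arity is carried by the length of the argument list: [eval c v y] has no
    solution [y] when [v] has a length that does not fit [c]. *)
Inductive recfun : Type :=
| Zero
| Succ
| Proj (i : nat)
| Comp (f : recfun) (gs : list recfun)
| Prec (f g : recfun)
| Mu (f : recfun).

Inductive eval : recfun -> list nat -> nat -> Prop :=
| eval_Zero v : eval Zero v 0
| eval_Succ x : eval Succ [x] (S x)
| eval_Proj i v x : nth_error v i = Some x -> eval (Proj i) v x
| eval_Comp f gs v w y :
    evals gs v w -> eval f w y -> eval (Comp f gs) v y
| eval_Prec_0 f g v y :
    eval f v y -> eval (Prec f g) (0 :: v) y
| eval_Prec_S f g n v r y :
    eval (Prec f g) (n :: v) r -> eval g (n :: r :: v) y ->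
    eval (Prec f g) (S n :: v) y
(* [y] is the least zero of [f (-, v)], and [f (z, v)] converges to the nonzero
   value [S (u z)] for every [z < y] *)
| eval_Mu f v y (u : nat -> nat) :
    (forall z, z < y -> eval f (z :: v) (S (u z))) ->
    eval f (y :: v) 0 ->
    eval (Mu f) v y
with evals : list recfun -> list nat -> list nat -> Prop :=
| evals_nil v : evals [] v []
| evals_cons g gs v z w :
    eval g v z -> evals gs v w -> evals (g :: gs) v (z :: w).

Definition computable (f : nat -> nat) : Prop :=
  exists c, forall x, eval c [x] (f x).

(** A binary relation is c.e. when it is the domain of a binary partial
    recursive function. *)
Definition comp_enum (R : relation nat) : Prop :=
  exists c, forall x y, R x y <-> exists z, eval c [x; y] z.

Definition ceer (R : relation nat) : Prop :=
  equivalence nat R /\ comp_enum R.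

Definition is_reduction (f : nat -> nat) (R S : relation nat) : Prop :=
  computable f /\ forall x y, R x y <-> S (f x) (f y).

Definition reducible (R S : relation nat) : Prop :=
  exists f, is_reduction f R S.

Definition strictly_reducible (R S : relation nat) : Prop :=
  reducible R S /\ ~ reducible S R.

Definition incomparable (R S : relation nat) : Prop :=
  ~ reducible R S /\ ~ reducible S R.

Definition universal (U : relation nat) : Prop :=
  ceer U /\ forall R, ceer R -> reducible R U.

Definition ujoin (R S : relation nat) : relation nat :=
  fun a b =>
    (exists x y, a = 2 * x /\ b = 2 * y /\ R x y) \/
    (exists x y, a = 2 * x + 1 /\ b = 2 * y + 1 /\ S x y).

(** [Id k] is congruence modulo [k], the usual representative of the ceers with
    exactly [k] classes. It is meant for [1 <= k] only: as [x mod 0 = x], [Id 0]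
    is equality on [nat]. *)
Definition Id (k : nat) : relation nat :=
  fun x y => x mod k = y mod k.

Lemma Id_classes k : 1 <= k -> forall x, exists! i, i < k /\ Id k x i.
Proof.
intros Hk x. assert (k <> 0) as Hk0 by (intros ->; inversion Hk).
exists (x mod k). unfold Id. split.
- split; [now apply Nat.mod_upper_bound | now rewrite Nat.Div0.mod_mod].
- intros i [Hi ->]. now apply Nat.mod_small.
Qed.

(** [A] joined with [Id n], where the join with [Id_0] is [A] by convention. *)
Definition join_Id (A : relation nat) (n : nat) : relation nat :=
  match n with
  | 0 => A
  | S _ => ujoin A (Id n)
  end.

Definition self_full (R : relation nat) : Prop :=
  forall f, is_reduction f R R -> forall y, exists x, R (f x) y.

Definition hereditarily_self_full (X : relation nat) : Prop :=
  forall Y, ceer Y -> self_full Y -> self_full (ujoin X Y).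

(* Main.v *)
Require Import Defs.
From Stdlib Require Import Arith List Relations.
From Stdlib Require Import Lia Cantor Classical ClassicalEpsilon.
Import ListNotations.
Local Open Scope bool_scope.

(** Call an element of a ceer [E] outside if its class contains no even number. Let [U] be a ceer
    with [U] not reducible to [B]. A finite injury construction yields a ceer [E] that codes [A] on
    the even numbers, has infinitely many outside classes, is not reducible to [B], and is such
    that the range of a computable function meeting infinitely many outside classes meets all
    classes. For the last property one merges, at most once for each function and class, an
    unrestrained outside class into the class that is to be met. For non-reducibility via the
    [n]-th function, [U] is copied to a growing list of fresh odd numbers that is lengthened only
    when the function appears to reduce its present part to [B]; lengthening forever would
    reduce [U] to [B].

    Let [f] reduce [X] to [E]. If its range meets all classes, then [E] reduces to [X]; otherwise
    it meets finitely many outside classes and [X] reduces to some [join_Id A k]. Moreover every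
    decidable set closed under [E] is trivial, so [E] reduces to a join only if it reduces to one
    side. This gives hereditary self-fullness once [E] is not reducible to [A]. It also shows that
    joins of non-universal ceers are non-universal, so [E l] can be built against the join of [A]
    and all the [E m] with [m < l]. Then [E l] does not reduce to [E m]; conversely
    a reduction of [E m] to [E l] would be strict, hence place [E m] below some [join_Id A k]. *)

(* Determinism of evaluation, and codes for arithmetic and Cantor pairing *)
Scheme eval_mind := Minimality for eval Sort Prop
  with evals_mind := Minimality for evals Sort Prop.
Combined Scheme eval_evals_ind from eval_mind, evals_mind.

Lemma eval_evals_functional :
  (forall c v y, eval c v y -> forall y', eval c v y' -> y = y') /\
  (forall gs v w, evals gs v w -> forall w', evals gs v w' -> w = w').
Proof.
apply eval_evals_ind.
- intros v y' H. now inversion H.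
- intros x y' H. now inversion H.
- intros i v x Hx y' H. inversion H. congruence.
- intros f gs v w y _ IHg _ IHf y' H. inversion H; subst.
  apply IHf. now rewrite (IHg _ H2).
- intros f g v y _ IH y' H. inversion H; subst. now apply IH.
- intros f g n v r y _ IHr _ IHy y' H. inversion H; subst.
  apply IHy. now rewrite (IHr _ H5).
- intros f v y u _ IHu _ IHy y' H. inversion H as [| | | | | |? ? ? u' Hu' Hy']; subst.
  (* At the smaller of two distinct candidates one evaluation gives 0 and the other a successor. *)
  destruct (Nat.lt_trichotomy y y') as [Hlt|[Heq|Hlt]]; [|exact Heq|].
  + now specialize (IHy _ (Hu' _ Hlt)).
  + now specialize (IHu _ Hlt _ Hy').
- intros v w' H. now inversion H.
- intros g gs v z w _ IHz _ IHw w' H. inversion H; subst. f_equal; auto.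
Qed.

Lemma eval_functional c v y y' : eval c v y -> eval c v y' -> y = y'.
Proof. intros H. now apply eval_evals_functional. Qed.

Lemma evals_1 g v z : eval g v z -> evals [g] v [z].
Proof. repeat constructor; trivial. Qed.

Lemma evals_2 g h v z w : eval g v z -> eval h v w -> evals [g; h] v [z; w].
Proof. repeat constructor; trivial. Qed.

Lemma eval_Comp1 f g v z y : eval g v z -> eval f [z] y -> eval (Comp f [g]) v y.
Proof. intros; econstructor; [apply evals_1|]; eassumption. Qed.

Lemma eval_Comp2 f g h v z w y :
  eval g v z -> eval h v w -> eval f [z; w] y -> eval (Comp f [g; h]) v y.
Proof. intros; econstructor; [apply evals_2|]; eassumption. Qed.

Definition add_code := Prec (Proj 0) (Comp Succ [Proj 1]).
Definition pred_code := Prec Zero (Proj 0).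
(** Primitive recursion runs on the first argument, so the subtrahend comes first. *)
Definition rsub_code := Prec (Proj 0) (Comp pred_code [Proj 1]).
Definition triangle_code := Prec Zero (Comp add_code [Comp Succ [Proj 0]; Proj 1]).
Definition pair_code :=
  Comp add_code [Proj 1; Comp triangle_code [Comp add_code [Proj 1; Proj 0]]].

Lemma eval_add n y : eval add_code [n; y] (n + y).
Proof.
induction n; simpl.
- constructor. now constructor.
- econstructor; [exact IHn|]. eapply eval_Comp1; now constructor.
Qed.

Lemma eval_pred n : eval pred_code [n] (pred n).
Proof.
induction n; simpl.
- repeat constructor.
- econstructor; [exact IHn|]. now constructor.
Qed.

Lemma eval_rsub n y : eval rsub_code [n; y] (y - n).
Proof.
induction n.
- rewrite Nat.sub_0_r. constructor. now constructor.
- rewrite Nat.sub_succ_r. econstructor; [exact IHn|].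
  eapply eval_Comp1; [now constructor|apply eval_pred].
Qed.

(** Spelled with [nat_rec] so that [to_nat (x, y)] is convertible to [y + triangle (y + x)]. *)
Definition triangle (n : nat) : nat := nat_rec (fun _ => nat) 0 (fun i m => S i + m) n.

Lemma triangle_S n : triangle (S n) = S n + triangle n.
Proof. reflexivity. Qed.

Lemma eval_triangle n : eval triangle_code [n] (triangle n).
Proof.
induction n.
- repeat constructor.
- rewrite triangle_S. econstructor; [exact IHn|].
  eapply eval_Comp2; [|now constructor|apply eval_add].
  eapply eval_Comp1; now constructor.
Qed.

Lemma eval_pair x y : eval pair_code [x; y] (to_nat (x, y)).
Proof.
eapply eval_Comp2; [now constructor| |apply eval_add].
eapply eval_Comp1; [|apply eval_triangle].
eapply eval_Comp2; [now constructor..|apply eval_add].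
Qed.

(** The largest [r] with [triangle r <= n], which recovers the sum of a coded pair. The truncated
    subtraction is 1 when the next triangular number has been reached and 0 otherwise. *)
Fixpoint triangle_root (n : nat) : nat :=
  match n with
  | 0 => 0
  | S m => 1 - (triangle (S (triangle_root m)) - S m) + triangle_root m
  end.

Lemma triangle_root_spec n :
  triangle (triangle_root n) <= n < triangle (S (triangle_root n)).
Proof.
induction n; [split; simpl; auto|].
cbn [triangle_root]. set (r := triangle_root n) in *.
assert (HS := triangle_S r). assert (HSS := triangle_S (S r)).
destruct (le_lt_dec (triangle (S r)) (S n)).
- replace (1 - (triangle (S r) - S n)) with 1 by lia. simpl (1 + r). lia.
- replace (1 - (triangle (S r) - S n)) with 0 by lia. simpl (0 + r). lia.
Qed.

Lemma triangle_le m n : m <= n -> triangle m <= triangle n.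
Proof. induction 1; rewrite ?triangle_S; lia. Qed.

Lemma triangle_root_to_nat x y : triangle_root (to_nat (x, y)) = y + x.
Proof.
change (to_nat (x, y)) with (y + triangle (y + x)).
destruct (triangle_root_spec (y + triangle (y + x))) as [H1 H2].
assert (HS := triangle_S (y + x)).
destruct (Nat.lt_trichotomy (triangle_root (y + triangle (y + x))) (y + x)) as [H|[H|H]].
- apply triangle_le in H. lia.
- exact H.
- apply triangle_le in H. lia.
Qed.

Definition triangle_root_code :=
  Prec Zero
    (Comp add_code
       [Comp rsub_code
          [Comp rsub_code [Comp Succ [Proj 0]; Comp triangle_code [Comp Succ [Proj 1]]];
           Comp Succ [Zero]];
        Proj 1]).

Lemma eval_triangle_root n : eval triangle_root_code [n] (triangle_root n).
Proof.
induction n.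
- repeat constructor.
- econstructor; [exact IHn|]. cbn [triangle_root].
  eapply eval_Comp2; [|now constructor|apply eval_add].
  eapply eval_Comp2; [| |apply eval_rsub].
  + eapply eval_Comp2; [| |apply eval_rsub].
    * eapply eval_Comp1; now constructor.
    * eapply eval_Comp1; [|apply eval_triangle]. eapply eval_Comp1; now constructor.
  + eapply eval_Comp1; constructor.
Qed.

(** * Closure properties of computable functions *)

Lemma computable_id : computable (fun x => x).
Proof. exists (Proj 0). intro. now constructor. Qed.

Lemma computable_S : computable S.
Proof. exists Succ. intro. constructor. Qed.

Lemma computable_0 : computable (fun _ => 0).
Proof. exists Zero. intro. constructor. Qed.

Lemma computable_comp f g : computable f -> computable g -> computable (fun x => f (g x)).
Proof.
intros [c Hc] [d Hd]. exists (Comp c [d]). intro x. eapply eval_Comp1; eauto.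
Qed.

Lemma computable_const k : computable (fun _ => k).
Proof.
induction k; [apply computable_0|].
apply (computable_comp S (fun _ => k)); [apply computable_S|assumption].
Qed.

Lemma computable_pair f g :
  computable f -> computable g -> computable (fun x => to_nat (f x, g x)).
Proof.
intros [c Hc] [d Hd]. exists (Comp pair_code [c; d]). intro x.
eapply eval_Comp2; [apply Hc|apply Hd|apply eval_pair].
Qed.

Lemma computable_snd : computable (fun z => snd (of_nat z)).
Proof.
exists (Comp rsub_code [Comp triangle_code [triangle_root_code]; Proj 0]).
intro z. eapply eval_Comp2.
- eapply eval_Comp1; [apply eval_triangle_root|apply eval_triangle].
- now constructor.
- replace (snd (of_nat z)) with (z - triangle (triangle_root z)); [apply eval_rsub|].
  rewrite <- (cancel_to_of z) at 1 2. destruct (of_nat z) as [x y].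
  rewrite triangle_root_to_nat. change (to_nat (x, y)) with (y + triangle (y + x)).
  simpl snd. lia.
Qed.

Lemma computable_fst : computable (fun z => fst (of_nat z)).
Proof.
destruct computable_snd as [c Hc].
exists (Comp rsub_code [c; triangle_root_code]).
intro z. eapply eval_Comp2; [apply Hc|apply eval_triangle_root|].
replace (fst (of_nat z)) with (triangle_root z - snd (of_nat z)); [apply eval_rsub|].
rewrite <- (cancel_to_of z) at 1. destruct (of_nat z) as [x y].
rewrite triangle_root_to_nat. simpl. lia.
Qed.

Lemma computable_rec b s :
  computable b -> computable s ->
  computable (fun p => nat_rect (fun _ => nat) (b (fst (of_nat p)))
    (fun n r => s (to_nat (fst (of_nat p), to_nat (n, r)))) (snd (of_nat p))).
Proof.
intros [cb Hb] [cs Hs].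
destruct computable_fst as [c1 H1], computable_snd as [c2 H2].
(* [Prec] passes the counter, the previous value and the parameter in this order; they are repacked
   into one number, parameter first. *)
set (step := Comp cs [Comp pair_code [Proj 2; Comp pair_code [Proj 0; Proj 1]]]).
exists (Comp (Prec cb step) [c2; c1]).
intro p. eapply eval_Comp2; [apply H2|apply H1|].
generalize (fst (of_nat p)) as v. induction (snd (of_nat p)) as [|n IHn]; intro v.
- constructor. apply Hb.
- econstructor; [apply IHn|]. cbn [nat_rect].
  eapply eval_Comp1; [|apply Hs].
  eapply eval_Comp2; [now constructor| |apply eval_pair].
  eapply eval_Comp2; [now constructor..|apply eval_pair].
Qed.

Opaque to_nat of_nat.

(** * Computability for typed data *)

Class Enc (T : Type) := {
  code : T -> nat;
  code_inj : forall x y, code x = code y -> x = y }.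

#[export] Instance Enc_nat : Enc nat := {| code := fun n => n; code_inj := fun _ _ e => e |}.

#[export, refine] Instance Enc_bool : Enc bool := {| code := Nat.b2n |}.
Proof. now intros [|] [|]. Defined.

#[export, refine] Instance Enc_prod A B `{Enc A} `{Enc B} : Enc (A * B) :=
  {| code := fun p => to_nat (code (fst p), code (snd p)) |}.
Proof.
intros [a b] [a' b'] e%to_nat_inj. injection e as e1 e2.
now apply code_inj in e1, e2; subst.
Defined.

#[export, refine] Instance Enc_list A `{Enc A} : Enc (list A) :=
  {| code := fold_right (fun a n => S (to_nat (code a, n))) 0 |}.
Proof.
induction x as [|a l IH]; intros [|a' l']; simpl; try easy.
intros [= e%to_nat_inj]. injection e as e1 e2.
apply code_inj in e1. apply IH in e2. now subst.
Defined.

Lemma code_cons {A} `{Enc A} (a : A) l : code (a :: l) = S (to_nat (code a, code l)).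
Proof. reflexivity. Qed.

(** The tracking function is arbitrary on numbers that code nothing, so injectivity is all that is
    asked of a coding. *)
Definition effective {A B} `{Enc A} `{Enc B} (f : A -> B) : Prop :=
  exists g, computable g /\ forall a, g (code a) = code (f a).

Lemma effective_computable (f : nat -> nat) : effective f <-> computable f.
Proof.
split.
- intros (g & [c Hc] & Hg). exists c. intro x. specialize (Hg x). simpl in Hg. rewrite <- Hg.
  apply Hc.
- intro H. now exists f.
Qed.

Lemma effective_ext {A B} `{Enc A} `{Enc B} (f f' : A -> B) :
  (forall a, f a = f' a) -> effective f -> effective f'.
Proof. intros E (g & Hg & Hf). exists g. split; [trivial|]. intro. now rewrite <- E. Qed.

Section BasicRules.
Context {V A B C : Type} `{EV : Enc V} `{EA : Enc A} `{EB : Enc B} `{EC : Enc C}.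

Lemma effective_comp (f : A -> B) (g : V -> A) :
  effective f -> effective g -> effective (fun v => f (g v)).
Proof.
intros (f' & Hf & Ef) (g' & Hg & Eg). exists (fun x => f' (g' x)). split.
- now apply computable_comp.
- intro. now rewrite Eg, Ef.
Qed.

Lemma effective_id : effective (fun v : V => v).
Proof. exists (fun x => x). split; [apply computable_id|reflexivity]. Qed.

Lemma effective_const (a : A) : effective (fun _ : V => a).
Proof. exists (fun _ => code a). split; [apply computable_const|reflexivity]. Qed.

Lemma effective_pair (f : V -> A) (g : V -> B) :
  effective f -> effective g -> effective (fun v => (f v, g v)).
Proof.
intros (f' & Hf & Ef) (g' & Hg & Eg). exists (fun x => to_nat (f' x, g' x)). split.
- now apply computable_pair.
- intro. now rewrite Ef, Eg.
Qed.

Lemma effective_fst (f : V -> A * B) : effective f -> effective (fun v => fst (f v)).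
Proof.
intros (f' & Hf & Ef). exists (fun x => fst (of_nat (f' x))). split.
- apply (computable_comp _ f' computable_fst Hf).
- intro. rewrite Ef. simpl. now rewrite cancel_of_to.
Qed.

Lemma effective_snd (f : V -> A * B) : effective f -> effective (fun v => snd (f v)).
Proof.
intros (f' & Hf & Ef). exists (fun x => snd (of_nat (f' x))). split.
- apply (computable_comp _ f' computable_snd Hf).
- intro. rewrite Ef. simpl. now rewrite cancel_of_to.
Qed.

Lemma effective_code (f : V -> A) : effective f -> effective (fun v => code (f v)).
Proof. intros (f' & Hf & Ef). now exists f'. Qed.

Lemma effective_to_nat (f : V -> nat * nat) : effective f -> effective (fun v => to_nat (f v)).
Proof.
intros (f' & Hf & Ef). exists f'. split; [trivial|]. intro. rewrite Ef. now destruct (f a).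
Qed.

Lemma effective_of_nat (f : V -> nat) : effective f -> effective (fun v => of_nat (f v)).
Proof.
intros (f' & Hf & Ef). exists f'. split; [trivial|]. intro. rewrite Ef. simpl.
rewrite <- surjective_pairing. now rewrite cancel_to_of.
Qed.

Lemma effective_S (f : V -> nat) : effective f -> effective (fun v => S (f v)).
Proof.
intros (f' & Hf & Ef). exists (fun x => S (f' x)). split.
- apply (computable_comp S f' computable_S Hf).
- intro. now rewrite Ef.
Qed.

(** The rules for conditionals, bounded loops and list iterators all rest on this one. *)
Lemma effective_nat_rect (b : V -> A) (s : V -> nat -> A -> A) (m : V -> nat) :
  effective b -> effective (fun w : V * (nat * A) => s (fst w) (fst (snd w)) (snd (snd w))) ->
  effective m -> effective (fun v => nat_rect (fun _ => A) (b v) (s v) (m v)).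
Proof.
intros (b' & Hb & Eb) (s' & Hs & Es) (m' & Hm & Em).
eexists. split.
- eapply computable_comp; [apply (computable_rec b' s' Hb Hs)|].
  apply computable_pair; [apply computable_id|apply Hm].
- intro v. cbv beta. rewrite cancel_of_to, Em. simpl fst. simpl snd.
  change (code (m v)) with (m v). induction (m v) as [|n IHn]; simpl; [apply Eb|].
  rewrite IHn. exact (Es (v, (n, _))).
Qed.

End BasicRules.

Section CurriedRules.
Context {V A B C D : Type} `{EV : Enc V} `{EA : Enc A} `{EB : Enc B} `{EC : Enc C} `{ED : Enc D}.

Lemma effective_if (b : V -> bool) (f g : V -> A) :
  effective b -> effective f -> effective g -> effective (fun v => if b v then f v else g v).
Proof.
intros Hb Hf Hg.
apply (effective_ext (fun v => nat_rect (fun _ => A) (g v) (fun _ _ => f v) (code (b v)))).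
{ intro v. now destruct (b v). }
apply effective_nat_rect; [exact Hg| |now apply effective_code].
destruct Hf as (f' & Hf & Ef). exists (fun x => f' (fst (of_nat x))). split.
- apply (computable_comp f' _ Hf computable_fst).
- intro. rewrite <- Ef. simpl. now rewrite cancel_of_to.
Qed.

Lemma effective_cons (f : V -> A) (g : V -> list A) :
  effective f -> effective g -> effective (fun v => f v :: g v).
Proof.
intros (f' & Hf & Ef) (g' & Hg & Eg). exists (fun x => S (to_nat (f' x, g' x))). split.
- apply (computable_comp S _ computable_S). now apply computable_pair.
- intro. now rewrite Ef, Eg.
Qed.

Definition effective2 (f : A -> B -> C) := effective (fun p => f (fst p) (snd p)).
Definition effective3 (f : A -> B -> C -> D) :=
  effective (fun p => f (fst p) (fst (snd p)) (snd (snd p))).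

Lemma effective_app2 (f : A -> B -> C) (a : V -> A) (b : V -> B) :
  effective2 f -> effective a -> effective b -> effective (fun v => f (a v) (b v)).
Proof.
intros Hf Ha Hb.
apply (effective_comp (fun p => f (fst p) (snd p)) (fun v => (a v, b v))); [exact Hf|].
now apply effective_pair.
Qed.

Lemma effective_app3 (f : A -> B -> C -> D) (a : V -> A) (b : V -> B) (c : V -> C) :
  effective3 f -> effective a -> effective b -> effective c ->
  effective (fun v => f (a v) (b v) (c v)).
Proof.
intros Hf Ha Hb Hc.
apply (effective_comp (fun p => f (fst p) (fst (snd p)) (snd (snd p)))
  (fun v => (a v, (b v, c v)))); [exact Hf|].
repeat apply effective_pair; assumption.
Qed.

End CurriedRules.

Create HintDb eff.

(* Extended below by the iterators on lists. *)
Ltac eff_iterator := fail.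

(* Rules are selected by the head symbol of the body, so that no rule fires by unfolding a
   defined function; the functions registered in [eff] are treated by the last three cases. *)
Ltac eff_step :=
  cbv beta;
  first [simple apply effective_id | simple apply effective_const |
  lazymatch goal with
  | |- effective (fun v => (@?a v, @?b v)) => apply (effective_pair a b)
  | |- effective (fun v => fst (@?a v)) => apply (effective_fst a)
  | |- effective (fun v => snd (@?a v)) => apply (effective_snd a)
  | |- effective (fun v => code (@?a v)) => apply (effective_code a)
  | |- effective (fun v => to_nat (@?a v)) => apply (effective_to_nat a)
  | |- effective (fun v => of_nat (@?a v)) => apply (effective_of_nat a)
  | |- effective (fun v => S (@?a v)) => apply (effective_S a)
  | |- effective (fun v => @?a v :: @?b v) => apply (effective_cons a b)
  | |- effective (fun v => if @?a v then @?b v else @?c v) => apply (effective_if a b c)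
  | |- effective (fun v => nat_rect _ (@?a v) (@?b v) (@?c v)) =>
      apply (effective_nat_rect a b c)
  end |
  eff_iterator |
  match goal with
  | |- effective (fun v => ?f (@?a v) (@?b v) (@?c v)) =>
      simple apply (effective_app3 f a b c); [solve [auto 1 with eff]| | |]
  | |- effective (fun v => ?f (@?a v) (@?b v)) =>
      simple apply (effective_app2 f a b); [solve [auto 1 with eff]| |]
  | |- effective (fun v => ?f (@?a v)) =>
      simple apply (effective_comp f a); [solve [auto 1 with eff]|]
  end].

Ltac eff := unfold effective2, effective3; repeat eff_step.

(** * Effectiveness of arithmetic, Boolean and list operations *)

Lemma effective_pred : effective pred.
Proof.
apply (effective_ext (fun n : nat => nat_rect (fun _ => nat) 0 (fun m _ => m) n)); [now intros []|].
eff.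
Qed.
#[export] Hint Resolve effective_pred : eff.

Lemma effective_add : effective2 Nat.add.
Proof.
apply (effective_ext (fun p : nat * nat => nat_rect (fun _ => nat) (snd p) (fun _ r => S r)
  (fst p))).
{ intros [m n]. simpl. induction m; simpl; congruence. }
eff.
Qed.
#[export] Hint Resolve effective_add : eff.

Lemma effective_sub : effective2 Nat.sub.
Proof.
apply (effective_ext (fun p : nat * nat => nat_rect (fun _ => nat) (fst p) (fun _ r => pred r)
  (snd p))).
{ intros [m n]. simpl. induction n; simpl; [|rewrite IHn]; lia. }
eff.
Qed.
#[export] Hint Resolve effective_sub : eff.

Lemma effective_mul : effective2 Nat.mul.
Proof.
apply (effective_ext (fun p : nat * nat => nat_rect (fun _ => nat) 0 (fun _ r => snd p + r)
  (fst p))).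
{ intros [m n]. simpl. induction m; simpl; congruence. }
eff.
Qed.
#[export] Hint Resolve effective_mul : eff.

Lemma effective_negb : effective negb.
Proof. apply (effective_ext (fun b : bool => if b then false else true)); [now intros []|eff]. Qed.
#[export] Hint Resolve effective_negb : eff.

Lemma effective_andb : effective2 andb.
Proof. apply (effective_ext (fun p : bool * bool => if fst p then snd p else false));
  [now intros [[] []]|eff]. Qed.
#[export] Hint Resolve effective_andb : eff.

Lemma effective_orb : effective2 orb.
Proof. apply (effective_ext (fun p : bool * bool => if fst p then true else snd p));
  [now intros [[] []]|eff]. Qed.
#[export] Hint Resolve effective_orb : eff.

Lemma effective_isZero : effective (Nat.eqb 0).
Proof.
apply (effective_ext (fun n : nat => nat_rect (fun _ => bool) true (fun _ _ => false) n)).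
{ now intros []. }
eff.
Qed.
#[export] Hint Resolve effective_isZero : eff.

Lemma effective_leb : effective2 Nat.leb.
Proof.
apply (effective_ext (fun p : nat * nat => 0 =? fst p - snd p)).
{ intros [m n]. simpl fst. simpl snd. destruct (Nat.leb_spec m n).
  - now replace (m - n) with 0 by lia.
  - destruct (m - n) eqn:E; [lia|reflexivity]. }
eff.
Qed.
#[export] Hint Resolve effective_leb : eff.

Lemma effective_eqb : effective2 Nat.eqb.
Proof.
apply (effective_ext (fun p : nat * nat => (fst p <=? snd p) && (snd p <=? fst p))).
{ intros [m n]. simpl fst. simpl snd. destruct (Nat.eqb_spec m n).
  - subst. now rewrite Nat.leb_refl.
  - apply Bool.not_true_iff_false. intros [H1%Nat.leb_le H2%Nat.leb_le]%andb_prop. lia. }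
eff.
Qed.
#[export] Hint Resolve effective_eqb : eff.

Definition eqc {A} `{Enc A} (a b : A) : bool := code a =? code b.

Lemma eqc_true {A} `{Enc A} (a b : A) : eqc a b = true <-> a = b.
Proof.
unfold eqc. rewrite Nat.eqb_eq. split; [apply code_inj|now intros ->].
Qed.

Lemma eqc_refl {A} `{Enc A} (a : A) : eqc a a = true.
Proof. now apply eqc_true. Qed.

Lemma effective_eqc {A} `{Enc A} : effective2 (eqc (A := A)).
Proof. unfold eqc. eff. Qed.
#[export] Hint Resolve effective_eqc : eff.

Lemma effective_even : effective Nat.even.
Proof.
apply (effective_ext (fun n : nat => nat_rect (fun _ => bool) true (fun _ b => negb b) n)).
{ induction a; [reflexivity|]. rewrite Nat.even_succ, <- Nat.negb_even. simpl. now f_equal. }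
eff.
Qed.
#[export] Hint Resolve effective_even : eff.

Lemma effective_odd : effective Nat.odd.
Proof. unfold Nat.odd. eff. Qed.
#[export] Hint Resolve effective_odd : eff.

Lemma effective_div2 : effective Nat.div2.
Proof.
apply (effective_ext (fun n : nat => nat_rect (fun _ => nat) 0 (fun m r => if Nat.odd m then S r
  else r) n)).
{ induction a as [|n IHn]; [reflexivity|]. cbn [nat_rect]. rewrite IHn.
  destruct (Nat.Even_or_Odd n) as [[m ->]|[m ->]].
  - rewrite Nat.odd_even, Nat.div2_even. replace (S (2 * m)) with (2 * m + 1) by lia.
    now rewrite Nat.div2_odd'.
  - rewrite Nat.odd_odd, Nat.div2_odd'. replace (S (2 * m + 1)) with (2 * S m) by lia.
    now rewrite Nat.div2_even. }
eff.
Qed.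
#[export] Hint Resolve effective_div2 : eff.

Lemma effective_mod : effective2 Nat.modulo.
Proof.
apply (effective_ext (fun p : nat * nat => nat_rect (fun _ => nat) 0
  (fun m r => if S r =? snd p then 0 else S r) (fst p))).
{ intros [n k]. simpl fst. simpl snd. induction n as [|n IHn]; [symmetry; apply Nat.Div0.mod_0_l|].
  cbn [nat_rect]. rewrite IHn. destruct k as [|k]; [reflexivity|].
  assert (Hd := Nat.div_mod_eq n (S k)). assert (Hm := Nat.mod_upper_bound n (S k)).
  destruct (Nat.eqb_spec (S (n mod S k)) (S k)) as [e|ne].
  - apply (Nat.mod_unique _ _ (S (n / S k))); lia.
  - apply (Nat.mod_unique _ _ (n / S k)); lia. }
eff.
Qed.
#[export] Hint Resolve effective_mod : eff.

Section LeftFold.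
Context {V A B : Type} `{EV : Enc V} `{EA : Enc A} `{EB : Enc B}.

Lemma effective_fold_left (F : V -> A -> B -> A) (l : V -> list B) (a : V -> A) :
  effective (fun w : V * (A * B) => F (fst w) (fst (snd w)) (snd (snd w))) ->
  effective l -> effective a -> effective (fun v => fold_left (F v) (l v) (a v)).
Proof.
intros (F' & HF & EF) (l' & Hl & El) (a' & Ha & Ea).
apply effective_computable in HF, Hl, Ha.
(* The state holds the code of the accumulator and the code of the remaining list. Code 0 is the
   empty list, and there the state no longer changes. *)
set (next := fun (v : nat) (st : nat * nat) =>
  if 0 =? snd st then st else
  (F' (to_nat (v, to_nat (fst st, fst (of_nat (pred (snd st)))))), snd (of_nat (pred (snd st))))).
(* The code of the list serves as the number of rounds; tails have smaller codes, so these rounds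
   suffice. *)
exists (fun v => fst (nat_rect (fun _ => nat * nat)%type (a' v,
  l' v) (fun _ st => next v st) (l' v))).
split; [apply effective_computable; unfold next; eff|].
intro v. rewrite El, Ea. generalize (a v) as a0, (l v) as l0. clear - EF.
assert (Hrec : forall n l0 a0, code l0 <= n ->
  nat_rect (fun _ => nat * nat)%type (code a0, code l0) (fun _ st => next (code v) st) n
  = (code (fold_left (F v) l0 a0), 0)).
(* [nat_rect] exposes its last round, while [fold_left] consumes the head first; this exposes the
   first round instead. *)
{ assert (Hshift : forall n x, nat_rect (fun _ => nat * nat)%type x (fun _ st => next (code v)
  st) (S n)
    = nat_rect (fun _ => nat * nat)%type (next (code v) x) (fun _ st => next (code v) st) n).
  { induction n; intro x; [reflexivity|]. cbn [nat_rect] in *. now rewrite IHn. }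
  induction n; intros [|b l0] a0 Hn; try reflexivity.
  - rewrite code_cons in Hn. lia.
  - rewrite Hshift. now apply (IHn []), Nat.le_0_l.
  - rewrite Hshift. rewrite code_cons in *. unfold next at 1. cbn [fst snd pred].
    rewrite cancel_of_to. cbn [fst snd].
    assert (E := EF (v, (a0, b))). cbn in E. rewrite E.
    change (fold_left (F v) (b :: l0) a0) with (fold_left (F v) l0 (F v a0 b)).
    rewrite <- IHn.
    + reflexivity.
    + assert (Hle := to_nat_non_decreasing (code b) (code l0)). lia. }
intros a0 l0. now rewrite Hrec.
Qed.

End LeftFold.

Ltac eff_iterator ::=
  lazymatch goal with
  | |- effective (fun v => fold_left (@?a v) (@?b v) (@?c v)) =>
      apply (effective_fold_left a b c)
  end.

Lemma effective_rev {A} `{Enc A} : effective (@rev A).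
Proof.
apply (effective_ext (fun l => fold_left (fun acc x => x :: acc) l [])).
{ intro l. rewrite <- fold_left_rev_right. change (fold_right _ [] ?m) with (fold_right cons [] m).
  generalize (rev l). induction l0; simpl; congruence. }
eff.
Qed.
#[export] Hint Resolve effective_rev : eff.

Section RightFold.
Context {V A B : Type} `{EV : Enc V} `{EA : Enc A} `{EB : Enc B}.

Lemma effective_fold_right (F : V -> B -> A -> A) (a : V -> A) (l : V -> list B) :
  effective (fun w : V * (A * B) => F (fst w) (snd (snd w)) (fst (snd w))) ->
  effective a -> effective l -> effective (fun v => fold_right (F v) (a v) (l v)).
Proof.
intros HF Ha Hl.
apply (effective_ext (fun v => fold_left (fun x y => F v y x) (rev (l v)) (a v))).
{ intro v. now rewrite <- fold_left_rev_right, rev_involutive. }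
eff; assumption.
Qed.

End RightFold.

Section BooleanIterators.
Context {V A : Type} `{EV : Enc V} `{EA : Enc A}.

Lemma effective_existsb (F : V -> A -> bool) (l : V -> list A) :
  effective (fun w : V * A => F (fst w) (snd w)) ->
  effective l -> effective (fun v => existsb (F v) (l v)).
Proof.
intros HF Hl.
apply (effective_ext (fun v => fold_right (fun x b => F v x || b) false (l v))).
{ intro v. induction (l v); simpl; congruence. }
apply (effective_fold_right (fun v x b => F v x || b)); [|apply effective_const|exact Hl].
change (effective2 (fun v x => F v x)) in HF.
apply (effective_app2 orb); eff.
Qed.

End BooleanIterators.

Section ListRules.
Context {V A : Type} `{EV : Enc V} `{EA : Enc A}.

Lemma effective_forallb (F : V -> A -> bool) (l : V -> list A) :
  effective (fun w : V * A => F (fst w) (snd w)) ->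
  effective l -> effective (fun v => forallb (F v) (l v)).
Proof.
intros HF Hl.
apply (effective_ext (fun v => negb (existsb (fun x => negb (F v x)) (l v)))).
{ intro v. induction (l v) as [|x m IH]; simpl; [reflexivity|]. rewrite <- IH.
  now destruct (F v x). }
eff_step. apply effective_existsb; [|exact Hl]. now apply (effective_comp negb); auto with eff.
Qed.

Lemma effective_filter (F : V -> A -> bool) (l : V -> list A) :
  effective (fun w : V * A => F (fst w) (snd w)) ->
  effective l -> effective (fun v => filter (F v) (l v)).
Proof.
intros HF Hl.
apply (effective_ext (fun v => fold_right (fun x m => if F v x then x :: m else m) [] (l v))).
{ intro v. induction (l v) as [|x m IH]; [reflexivity|]. simpl. now rewrite IH. }
apply (effective_fold_right (fun v x m => if F v x then x :: m else m));
  [|apply effective_const|exact Hl].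
change (effective2 (fun v x => F v x)) in HF.
apply effective_if; eff.
Qed.

Lemma effective_length : effective (@length A).
Proof.
apply (effective_ext (fun l => fold_left (fun n _ => S n) l 0)).
{ assert (H : forall l n, fold_left (fun n (_ : A) => S n) l n = length l + n).
  { induction l as [|x l IH]; intro n; [reflexivity|]. simpl. rewrite IH. lia. }
  intro l. rewrite H. lia. }
eff.
Qed.

Lemma effective_hd : effective2 (@hd A).
Proof.
apply (effective_ext (fun p : A * list A => fold_left (fun _ x => x) (rev (snd p)) (fst p))).
{ intros [d l]. simpl. rewrite <- fold_left_rev_right, rev_involutive. now destruct l. }
eff.
Qed.

Lemma effective_tl : effective (@tl A).
Proof.
(* The fold rebuilds the list from its end and carries each suffix together with the tail of that
   suffix. *)
apply (effective_ext (fun l => snd (fold_left (fun (acc : list A * list A) x => (x :: fst acc,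
  fst acc))
  (rev l) ([], [])))).
{ assert (H : forall l : list A, fold_left (fun (acc : list A * list A) x => (x :: fst acc,
  fst acc))
    (rev l) ([], []) = (l, tl l)).
  { intro l. rewrite <- fold_left_rev_right, rev_involutive.
    induction l as [|x l IH]; [reflexivity|]. simpl. now rewrite IH. }
  intro l. now rewrite H. }
eff.
Qed.

End ListRules.
#[export] Hint Resolve effective_length effective_hd effective_tl : eff.

Fixpoint forall_below (n : nat) (P : nat -> bool) : bool :=
  match n with
  | 0 => true
  | S m => forall_below m P && P m
  end.

Lemma forall_below_true n P : forall_below n P = true <-> forall z, z < n -> P z = true.
Proof.
induction n as [|n IH]; simpl; [easy|]. rewrite Bool.andb_true_iff, IH. split.
- intros [H Hn] z Hz. destruct (Nat.eq_dec z n) as [->|]; [trivial|]. apply H. lia.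
- intro H. split; auto with arith.
Qed.

Lemma effective_forall_below {V} `{Enc V} (P : V -> nat -> bool) (n : V -> nat) :
  effective (fun w : V * nat => P (fst w) (snd w)) -> effective n ->
  effective (fun v => forall_below (n v) (P v)).
Proof.
intros HP Hn.
apply (effective_ext (fun v => nat_rect (fun _ => bool) true (fun m b => b && P v m) (n v))).
{ intro v. induction (n v); simpl; congruence. }
change (effective2 (fun v x => P v x)) in HP.
apply effective_nat_rect; [eff| |exact Hn]. apply (effective_app2 andb); eff.
Qed.

Ltac eff_iterator ::=
  lazymatch goal with
  | |- effective (fun v => fold_left (@?a v) (@?b v) (@?c v)) =>
      apply (effective_fold_left a b c)
  | |- effective (fun v => fold_right (@?a v) (@?b v) (@?c v)) =>
      apply (effective_fold_right a b c)
  | |- effective (fun v => existsb (@?a v) (@?b v)) => apply (effective_existsb a b)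
  | |- effective (fun v => forallb (@?a v) (@?b v)) => apply (effective_forallb a b)
  | |- effective (fun v => filter (@?a v) (@?b v)) => apply (effective_filter a b)
  | |- effective (fun v => forall_below (@?a v) (@?b v)) => apply (effective_forall_below b a)
  end.

Lemma effective_nth {A} `{Enc A} : effective3 (@nth A).
Proof.
apply (effective_ext (fun p : nat * (list A * A) =>
  hd (snd (snd p)) (nat_rect (fun _ => list A) (fst (snd p)) (fun _ l => tl l) (fst p)))).
{ intros [i [l d]]. simpl fst. simpl snd.
  assert (Hs : nat_rect (fun _ => list A) l (fun _ l => tl l) i = skipn i l).
  { revert l. induction i as [|i IH]; intro l; [reflexivity|].
    cbn [nat_rect]. rewrite IH. clear. revert l. induction i; intros [|x l]; try reflexivity.
      apply IHi. }
  rewrite Hs. clear Hs. revert l. induction i; intros [|x l]; try reflexivity. apply IHi. }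
eff.
Qed.
#[export] Hint Resolve effective_nth : eff.

Lemma effective_ltb : effective2 Nat.ltb.
Proof. unfold Nat.ltb. eff. Qed.
#[export] Hint Resolve effective_ltb : eff.

(** * Unbounded search *)

Lemma least_witness (P : nat -> bool) n :
  P n = true -> exists m, P m = true /\ forall z, z < m -> P z = false.
Proof.
induction n as [n IH] using lt_wf_ind. intro Hn.
destruct (classic (exists z, z < n /\ P z = true)) as [(z & Hz & Pz)|H].
- now apply (IH z).
- exists n. split; [trivial|]. intros z Hz. apply Bool.not_true_is_false. firstorder.
Qed.

(** [Mu] looks for zeros, hence the negation. *)
Lemma search_code (b : nat -> nat -> bool) : effective2 b ->
  exists c, forall m x, eval c [m; x] (Nat.b2n (negb (b m x))).
Proof.
intro Hb.
assert (Hn : effective (fun p => negb (b (fst p) (snd p)))) by (apply (effective_comp negb);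
  auto with eff).
destruct Hn as (t & [c Hc] & Ht).
exists (Comp c [Comp pair_code [Proj 0; Proj 1]]). intros m x.
eapply eval_Comp1; [eapply eval_Comp2; [now constructor..|apply eval_pair]|].
specialize (Ht (m, x)). simpl in Ht. rewrite <- Ht. apply Hc.
Qed.

Lemma eval_Mu_bool c P v m :
  (forall z, eval c (z :: v) (Nat.b2n (negb (P z)))) ->
  P m = true -> (forall z, z < m -> P z = false) -> eval (Mu c) v m.
Proof.
(* A failed test has value 1, the successor of 0. *)
intros Hc Hm Hz. apply (eval_Mu _ _ _ (fun _ => 0)).
- intros z Hlt. specialize (Hc z). now rewrite Hz in Hc.
- specialize (Hc m). now rewrite Hm in Hc.
Qed.

(** The description operator only names the result of the search; computability comes from the code
    [Mu c]. *)
Lemma effective_choice (b : nat -> nat -> bool) :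
  effective2 b -> (forall x, exists n, b n x = true) ->
  exists g, effective g /\ forall x, b (g x) x = true.
Proof.
intros Hb Hex. destruct (search_code b Hb) as [c Hc].
assert (H : forall x, exists m, b m x = true /\ eval (Mu c) [x] m).
{ intro x. destruct (Hex x) as [n Hn].
  destruct (least_witness (fun n => b n x) n Hn) as (m & Hm & Hz).
  exists m. split; [trivial|]. now apply eval_Mu_bool with (P := fun n => b n x). }
exists (fun x => proj1_sig (constructive_indefinite_description _ (H x))). split.
- apply effective_computable. exists (Mu c). intro x.
  destruct (constructive_indefinite_description _ (H x)) as [m Hm]. apply Hm.
- intro x. destruct (constructive_indefinite_description _ (H x)) as [m Hm]. apply Hm.
Qed.

Lemma comp_enum_exists (b : nat -> nat -> nat -> bool) :
  effective3 b -> comp_enum (fun x y => exists n, b n x y = true).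
Proof.
intro Hb.
destruct (search_code (fun n p => b n (fst (of_nat p)) (snd (of_nat p)))) as [c Hc].
{ eff. }
set (c' := Comp c [Proj 0; Comp pair_code [Proj 1; Proj 2]]).
assert (Hc' : forall n x y, eval c' [n; x; y] (Nat.b2n (negb (b n x y)))).
{ intros n x y. eapply eval_Comp2; [now constructor|eapply eval_Comp2;
  [now constructor..|apply eval_pair]|].
  specialize (Hc n (to_nat (x, y))). now rewrite cancel_of_to in Hc. }
exists (Mu c'). intros x y. split.
- intros [n Hn]. destruct (least_witness (fun n => b n x y) n Hn) as (m & Hm & Hz).
  exists m. now apply eval_Mu_bool with (P := fun n => b n x y).
- intros [z Hz]. exists z. inversion Hz as [| | | | | |f v y' u Hu Hy]; subst.
  assert (E := eval_functional _ _ _ _ (Hc' z x y) Hy). now destruct (b z x y).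
Qed.

(** * An enumeration of all computations *)

Fixpoint gn (c : recfun) : nat :=
  match c with
  | Zero => to_nat (0, 0)
  | Succ => to_nat (1, 0)
  | Proj i => to_nat (2, i)
  | Comp f gs =>
      to_nat (3, to_nat (gn f,
        (fix gnl (gs : list recfun) : nat :=
           match gs with
           | [] => to_nat (6, 0)
           | g :: gs => to_nat (7, to_nat (gn g, gnl gs))
           end) gs))
  | Prec f g => to_nat (4, to_nat (gn f, gn g))
  | Mu f => to_nat (5, gn f)
  end.

(** The inner fixpoint of [gn] again, at top level, so that lists of codes have numbers of their
    own. *)
Fixpoint gnl (gs : list recfun) : nat :=
  match gs with
  | [] => to_nat (6, 0)
  | g :: gs => to_nat (7, to_nat (gn g, gnl gs))
  end.

Lemma gn_Comp f gs : gn (Comp f gs) = to_nat (3, to_nat (gn f, gnl gs)).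
Proof.
reflexivity.
Qed.

(* Tags 6 and 7 of [gnl] make lists of codes evaluate by the same kind of judgment: [(c, (v, w))]
   says that [c] takes the arguments [v] to the list of values [w], which is [[y]] for the code
   of a single function. *)
Definition judgment : Type := nat * (list nat * list nat).

Definition mem {A} `{Enc A} (a : A) (l : list A) : bool := existsb (eqc a) l.

Lemma mem_In {A} `{Enc A} (a : A) l : mem a l = true <-> In a l.
Proof.
unfold mem. rewrite existsb_exists. split.
- intros (x & Hx & E). rewrite eqc_true in E. now subst.
- intro Ha. exists a. split; [trivial|apply eqc_refl].
Qed.

Lemma effective_mem {A} `{Enc A} : effective2 (mem (A := A)).
Proof. unfold mem. eff. Qed.
#[export] Hint Resolve effective_mem : eff.

(** One clause per evaluation rule: [p] follows by a single rule from judgments in [T]. Intermediate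
    values that a rule leaves open are searched for in [T]. *)
Definition justified (T : list judgment) (p : judgment) : bool :=
  let tag := fst (of_nat (fst p)) in
  let c := snd (of_nat (fst p)) in
  let a := fst (of_nat c) in
  let b := snd (of_nat c) in
  let v := fst (snd p) in
  let w := snd (snd p) in
  let n := hd 0 v in
  (tag =? 0) && eqc w [0] ||
  (tag =? 1) && (eqc v [n] && eqc w [S n]) ||
  (tag =? 2) && ((c <? length v) && eqc w [nth c v 0]) ||
  (tag =? 3) && existsb (fun q => (fst q =? b) && eqc (fst (snd q)) v &&
    mem (a, (snd (snd q), w)) T) T ||
  (tag =? 4) && ((0 <? length v) &&
    (if n =? 0 then mem (a, (tl v, w)) T else
     existsb (fun q => (fst q =? fst p) && eqc (fst (snd q)) (pred n :: tl v) &&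
       mem (b, (pred n :: hd 0 (snd (snd q)) :: tl v, w)) T) T)) ||
  (tag =? 5) && (eqc w [hd 0 w] && mem (c, (hd 0 w :: v, [0])) T &&
    forall_below (hd 0 w) (fun z => existsb (fun q => (fst q =? c) && eqc (fst (snd q)) (z :: v) &&
      negb (hd 0 (snd (snd q)) =? 0)) T)) ||
  (tag =? 6) && eqc w [] ||
  (tag =? 7) && ((0 <? length w) && mem (a, (v, [hd 0 w])) T && mem (b, (v, tl w)) T).

Lemma effective_justified : effective2 justified.
Proof.
unfold justified. cbv zeta. unfold judgment. eff.
Qed.
#[export] Hint Resolve effective_justified : eff.

(** * Properties of all late stages, and requests that recur *)

Definition eventually (P : nat -> Prop) : Prop := exists s0, forall s, s0 <= s -> P s.

Lemma eventually_and P Q : eventually P -> eventually Q -> eventually (fun s => P s /\ Q s).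
Proof.
intros [s HP] [t HQ]. exists (max s t). intros r Hr. split; [apply HP|apply HQ]; lia.
Qed.

Lemma eventually_impl (P Q : nat -> Prop) :
  (forall s, P s -> Q s) -> eventually P -> eventually Q.
Proof. intros H [s HP]. exists s. auto. Qed.

Lemma eventually_Forall {A} (P : A -> nat -> Prop) l :
  (forall x, In x l -> eventually (P x)) -> eventually (fun s => forall x, In x l -> P x s).
Proof.
induction l as [|x l IH]; intro H.
- now exists 0.
- destruct (eventually_and _ _ (H x (or_introl eq_refl)) (IH (fun y Hy => H y (or_intror Hy))))
    as [s Hs].
  exists s. intros t Ht. destruct (Hs t Ht) as [Hx Hl]. intros y [<-|Hy]; auto.
Qed.

Lemma eventually_forall_below (P : nat -> nat -> Prop) n :
  (forall x, x < n -> eventually (P x)) -> eventually (fun s => forall x, x < n -> P x s).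
Proof.
intro H. eapply eventually_impl; [|apply (eventually_Forall P (seq 0 n))].
- intros s Hs x Hx. apply Hs, in_seq. lia.
- intros x Hx. apply in_seq in Hx. apply H. lia.
Qed.

(** The first component tells how many numbers to unpack from the second, so a bounded loop suffices
    and every list is reached. *)
Definition list_of_nat (n : nat) : list nat :=
  fst (nat_rect (fun _ => list nat * nat)%type ([], snd (of_nat n))
    (fun _ st => (fst (of_nat (snd st)) :: fst st, snd (of_nat (snd st)))) (fst (of_nat n))).

Lemma effective_list_of_nat : effective list_of_nat.
Proof. unfold list_of_nat. eff. Qed.
#[export] Hint Resolve effective_list_of_nat : eff.

Lemma list_of_nat_surj l : exists n, list_of_nat n = l.
Proof.
assert (H : forall l r, exists n, nat_rect (fun _ => list nat * nat)%type ([], n)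
  (fun _ st => (fst (of_nat (snd st)) :: fst st, snd (of_nat (snd st)))) (length l) = (l, r)).
{ clear l. induction l as [|x l IH]; intro r.
  - now exists r.
  - destruct (IH (to_nat (x, r))) as [n Hn]. exists n. cbn [length nat_rect]. rewrite Hn. simpl.
    rewrite cancel_of_to. reflexivity. }
destruct (H l 0) as [n Hn]. exists (to_nat (length l, n)).
unfold list_of_nat. rewrite cancel_of_to. cbn [fst snd]. now rewrite Hn.
Qed.

(* Stage [s] of an enumeration treats the request coded by [proposal s]; every request is
   treated infinitely often, so no search over requests is needed. *)
Definition proposal (s : nat) : nat := fst (of_nat s).

Lemma effective_proposal : effective proposal.
Proof. unfold proposal. eff. Qed.
#[export] Hint Resolve effective_proposal : eff.

Lemma proposal_recurs n s : exists t, s <= t /\ proposal t = n.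
Proof.
exists (to_nat (n, s)). unfold proposal. rewrite cancel_of_to. split; [|reflexivity].
assert (H := to_nat_non_decreasing n s). lia.
Qed.

Definition judgment_of_nat (n : nat) : judgment :=
  (fst (of_nat n),
   (list_of_nat (fst (of_nat (snd (of_nat n)))), list_of_nat (snd (of_nat (snd (of_nat n)))))).

Lemma judgment_of_nat_surj p : exists n, judgment_of_nat n = p.
Proof.
destruct p as [c [v w]].
destruct (list_of_nat_surj v) as [n Hn], (list_of_nat_surj w) as [m Hm].
exists (to_nat (c, to_nat (n, m))). unfold judgment_of_nat.
rewrite cancel_of_to. cbn [fst snd]. rewrite cancel_of_to. cbn [fst snd]. now rewrite Hn, Hm.
Qed.

(* Adding only undecided judgments makes the table functional even for numbers that are not
   codes, see [Tab_functional]. *)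
Definition decided (T : list judgment) (p : judgment) : bool :=
  existsb (fun q => eqc (fst q, fst (snd q)) (fst p, fst (snd p))) T.

Definition extend (T : list judgment) (p : judgment) : list judgment :=
  if justified T p && negb (decided T p) then p :: T else T.

Definition Tab (s : nat) : list judgment :=
  nat_rect (fun _ => list judgment) [] (fun t T => extend T (judgment_of_nat (proposal t))) s.

Lemma effective_Tab : effective Tab.
Proof.
unfold Tab, extend, decided, judgment_of_nat. eff.
Qed.
#[export] Hint Resolve effective_Tab : eff.

Lemma Tab_S s : Tab (S s) = extend (Tab s) (judgment_of_nat (proposal s)).
Proof. reflexivity. Qed.

Lemma Tab_mono s t p : s <= t -> In p (Tab s) -> In p (Tab t).
Proof.
induction 1 as [|t _ IH]; [trivial|]. intro Hp. rewrite Tab_S. unfold extend.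
destruct (_ && _); [right|]; auto.
Qed.

Lemma Tab_functional s c v w w' : In (c, (v, w)) (Tab s) -> In (c, (v, w')) (Tab s) -> w = w'.
Proof.
induction s as [|s IH]; [easy|]. rewrite Tab_S. unfold extend.
destruct (_ && _) eqn:E; [|exact IH].
apply andb_prop in E as [_ E].
assert (Hnew : forall u, In (c, (v, u)) (Tab s) ->
  fst (judgment_of_nat (proposal s)) = c -> fst (snd (judgment_of_nat (proposal s))) = v -> False).
{ intros u Hu <- <-. apply Bool.negb_true_iff, Bool.not_true_iff_false in E. apply E.
  unfold decided. apply existsb_exists. eexists. split; [exact Hu|]. apply eqc_refl. }
intros [H|H] [H'|H'].
- congruence.
- exfalso. apply (Hnew w' H'); now rewrite H.
- exfalso. apply (Hnew w H); now rewrite H'.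
- now apply IH.
Qed.

(** The table may also contain judgments about numbers that code nothing; of these nothing is
    claimed. *)
Definition sound (p : judgment) : Prop :=
  (forall c, fst p = gn c -> exists y, snd (snd p) = [y] /\ eval c (fst (snd p)) y) /\
  (forall gs, fst p = gnl gs -> evals gs (fst (snd p)) (snd (snd p))).

Lemma cons_hd_tl {A} (d : A) l : 0 < length l -> l = hd d l :: tl l.
Proof. destruct l; simpl; [lia|reflexivity]. Qed.

Ltac bools := repeat match goal with
  | H : _ && _ = true |- _ => apply andb_prop in H; destruct H
  | H : negb _ = true |- _ => rewrite Bool.negb_true_iff in H
  | H : (_ =? _) = true |- _ => rewrite Nat.eqb_eq in H
  | H : (_ =? _) = false |- _ => rewrite Nat.eqb_neq in H
  | H : (_ <? _) = true |- _ => rewrite Nat.ltb_lt in H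
  | H : (_ <=? _) = true |- _ => rewrite Nat.leb_le in H
  | H : eqc _ _ = true |- _ => rewrite eqc_true in H
  | H : mem _ _ = true |- _ => rewrite mem_In in H
  | H : forall_below _ _ = true |- _ => rewrite forall_below_true in H
  end.

Lemma justified_sound T p : (forall q, In q T -> sound q) -> justified T p = true -> sound p.
Proof.
intros HT Hj. destruct p as [d [v w]].
assert (HTe : forall c v w, In (gn c, (v, w)) T -> exists y, w = [y] /\ eval c v y).
{ intros c v' w' H. now apply (HT _ H). }
assert (HTes : forall gs v w, In (gnl gs, (v, w)) T -> evals gs v w).
{ intros gs v' w' H. now apply (HT _ H). }
split; cbn [fst snd].
- intros c ->. unfold justified in Hj. cbv zeta in Hj. cbn [fst snd] in Hj.
  destruct c as [| |i|f gs|f g|f]; rewrite ?gn_Comp in Hj; cbn [gn] in Hj;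
    rewrite ?cancel_of_to in Hj; cbn [fst snd Nat.eqb andb orb] in Hj;
    rewrite ?cancel_of_to, ?Bool.orb_false_r in Hj; cbn [fst snd] in Hj.
  + bools. subst. eexists. split; [reflexivity|constructor].
  + bools. rewrite H. subst. eexists. split; [reflexivity|constructor].
  + bools. subst. eexists. split; [reflexivity|]. constructor. now apply nth_error_nth'.
  + apply existsb_exists in Hj as ([d [v' u]] & Hq & Hj). cbn [fst snd] in Hj. bools. subst.
    apply HTe in H0 as (y & -> & Hy). exists y. split; [reflexivity|].
    econstructor; [eapply HTes, Hq|exact Hy].
  + apply andb_prop in Hj as [Hlen Hj]. bools. rewrite (cons_hd_tl 0 v Hlen).
    destruct (hd 0 v) as [|n]; cbn [Nat.eqb] in Hj.
    * bools. apply HTe in Hj as (y & -> & Hy). exists y. split; [reflexivity|]. now constructor.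
    * apply existsb_exists in Hj as ([d [v' u]] & Hq & Hj). cbn [fst snd pred] in Hj. bools. subst.
      apply (HTe (Prec f g)) in Hq as (r & -> & Hr).
      apply HTe in H0 as (y & -> & Hy). exists y. split; [reflexivity|].
      econstructor; eassumption.
  + bools. set (m := hd 0 w) in *. exists m. split; [assumption|].
    apply HTe in H1 as (y & [= <-] & Hy).
    assert (Hz : forall z, z < m -> exists u, eval f (z :: v) (S u)).
    { intros z Hz. specialize (H0 z Hz).
      apply existsb_exists in H0 as ([d [v' u]] & Hq & Hj). cbn [fst snd] in Hj. bools. subst d v'.
      apply HTe in Hq as (r & -> & Hr). cbn [hd] in H1.
      destruct r as [|r]; [easy|]. now exists r. }
    (* [eval_Mu] takes a function on all numbers, so the witnesses found below [m] are extended by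
       the default 0. *)
    apply (eval_Mu _ _ _ (fun z => match lt_dec z m with
      | left h => proj1_sig (constructive_indefinite_description _ (Hz z h))
      | right _ => 0 end)); [|exact Hy].
    intros z h. destruct (lt_dec z m) as [h'|]; [|easy].
    now destruct (constructive_indefinite_description _ (Hz z h')).
- intros gs ->. unfold justified in Hj. cbv zeta in Hj. cbn [fst snd] in Hj.
  destruct gs as [|g gs]; cbn [gnl] in Hj;
    rewrite ?cancel_of_to in Hj; cbn [fst snd Nat.eqb andb orb] in Hj;
    rewrite ?cancel_of_to, ?Bool.orb_false_r in Hj; cbn [fst snd] in Hj; bools.
  + subst. constructor.
  + rewrite (cons_hd_tl 0 w H). apply HTe in H1 as (y & [= ->] & Hy).
    constructor; [exact Hy|now apply HTes].
Qed.

Lemma Tab_sound s p : In p (Tab s) -> sound p.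
Proof.
revert p. induction s as [|s IH]; [easy|]. intros p. rewrite Tab_S. unfold extend.
destruct (_ && _) eqn:E; [|apply IH]. apply andb_prop in E as [E _].
intros [<-|H]; [|now apply IH]. now apply (justified_sound (Tab s)).
Qed.

Lemma Tab_eval s c v w : In (gn c, (v, w)) (Tab s) -> exists y, w = [y] /\ eval c v y.
Proof. intro H. now apply (Tab_sound s _ H). Qed.

Lemma Tab_evals s gs v w : In (gnl gs, (v, w)) (Tab s) -> evals gs v w.
Proof. intro H. now apply (Tab_sound s _ H). Qed.

Definition tabulated (p : judgment) : Prop := eventually (fun s => In p (Tab s)).

(** When the judgment is proposed at a late stage, either it is entered or the table already decides
    the same arguments, by uniqueness with the same values. *)
Lemma tabulated_justified c v w :
  (forall s w', In (c, (v, w')) (Tab s) -> w' = w) ->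
  eventually (fun s => justified (Tab s) (c, (v, w)) = true) -> tabulated (c, (v, w)).
Proof.
intros Huniq [s0 Hs0]. destruct (judgment_of_nat_surj (c, (v, w))) as [n Hn].
destruct (proposal_recurs n s0) as (s & Hs & Hp).
assert (H : In (c, (v, w)) (Tab (S s))).
{ rewrite Tab_S, Hp, Hn. unfold extend. rewrite (Hs0 s Hs). simpl.
  destruct (decided (Tab s) (c, (v, w))) eqn:E; [|now left].
  apply existsb_exists in E as ([c' [v' w']] & Hq & E). rewrite eqc_true in E.
  injection E as -> ->. assert (E := Huniq s w' Hq). now subst. }
exists (S s). intros t Ht. now apply (Tab_mono (S s)).
Qed.

Lemma eval_tabulated :
  (forall c v y, eval c v y -> tabulated (gn c, (v, [y]))) /\
  (forall gs v w, evals gs v w -> tabulated (gnl gs, (v, w))).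
Proof.
assert (Hc : forall c v y, eval c v y ->
  eventually (fun s => justified (Tab s) (gn c, (v, [y])) = true) -> tabulated (gn c, (v, [y]))).
{ intros c v y Hy. apply tabulated_justified. intros s w' Hw'.
  destruct (Tab_eval _ _ _ _ Hw') as (y' & -> & Hy'). f_equal. now apply (eval_functional c v). }
assert (Hs : forall gs v w, evals gs v w ->
  eventually (fun s => justified (Tab s) (gnl gs, (v, w)) = true) -> tabulated (gnl gs, (v, w))).
{ intros gs v w Hw. apply tabulated_justified. intros s w' Hw'. apply Tab_evals in Hw'.
  now apply (proj2 eval_evals_functional gs v). }
Ltac justify_step := unfold justified; cbv zeta; rewrite ?gn_Comp; cbn [gn gnl fst snd];
  rewrite ?cancel_of_to; cbn [fst snd Nat.eqb andb orb];
  rewrite ?cancel_of_to, ?Bool.orb_false_r; cbn [fst snd].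
apply eval_evals_ind.
- intro v. apply Hc; [constructor|]. exists 0. intros s _. justify_step. apply eqc_refl.
- intro x. apply Hc; [constructor|]. exists 0. intros s _. justify_step.
  apply andb_true_intro; split; apply eqc_refl.
- intros i v x Hx. apply Hc; [now constructor|]. exists 0. intros s _. justify_step.
  rewrite (nth_error_nth _ _ 0 Hx). apply andb_true_intro; split; [|apply eqc_refl].
  apply Nat.ltb_lt, nth_error_Some. congruence.
- intros f gs v w y Hg IHg Hf IHf. apply Hc; [econstructor; eassumption|].
  (* Only exposes the [eventually] hidden in [tabulated]. *)
  apply (eventually_impl _ _ (fun s H => H) ) in IHg.
  destruct (eventually_and _ _ IHg IHf) as [s0 Hs0]. exists s0. intros s Hle. justify_step.
  destruct (Hs0 s Hle) as [H1 H2].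
  apply existsb_exists. eexists. split; [exact H1|]. cbn [fst snd].
  rewrite Nat.eqb_refl, eqc_refl. now apply mem_In.
- intros f g v y Hf IHf. apply Hc; [now constructor|].
  destruct IHf as [s0 Hs0]. exists s0. intros s Hle. justify_step.
  cbn [length hd tl Nat.eqb]. now apply mem_In, Hs0.
- intros f g n v r y Hr IHr Hy IHy. apply Hc; [econstructor; eassumption|].
  destruct (eventually_and _ _ IHr IHy) as [s0 Hs0]. exists s0. intros s Hle. justify_step.
  destruct (Hs0 s Hle) as [H1 H2]. cbn [length hd tl Nat.eqb pred]. simpl.
  apply existsb_exists. eexists. split; [exact H1|]. cbn [fst snd hd].
  rewrite Nat.eqb_refl, eqc_refl. now apply mem_In.
- intros f v y u Hu IHu Hy IHy. apply Hc; [econstructor; eassumption|].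
  apply (eventually_forall_below (fun z s => In (gn f, (z :: v, [S (u z)])) (Tab s))) in IHu.
  destruct (eventually_and _ _ IHu IHy) as [s0 Hs0]. exists s0. intros s Hle. justify_step.
  destruct (Hs0 s Hle) as [H1 H2]. cbn [hd]. rewrite eqc_refl.
  rewrite (proj2 (mem_In _ _) H2). apply forall_below_true. intros z Hz.
  apply existsb_exists. eexists. split; [apply (H1 z Hz)|]. cbn [fst snd hd].
  now rewrite Nat.eqb_refl, eqc_refl.
- intro v. apply Hs; [constructor|]. exists 0. intros s _. justify_step. apply eqc_refl.
- intros g gs v z w Hz IHz Hw IHw. apply Hs; [now constructor|].
  destruct (eventually_and _ _ IHz IHw) as [s0 Hs0]. exists s0. intros s Hle. justify_step.
  destruct (Hs0 s Hle) as [H1 H2]. cbn [length hd tl].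
  rewrite (proj2 (mem_In _ _) H1). now apply mem_In.
Qed.

Lemma tabulated_eval c v y : eval c v y -> tabulated (gn c, (v, [y])).
Proof. apply eval_tabulated. Qed.

(** * Monotone approximations of c.e. relations *)

Definition enumerated (R : relation nat) (b : nat -> nat -> nat -> bool) : Prop :=
  effective3 b /\ (forall s t x y, s <= t -> b s x y = true -> b t x y = true) /\
  forall x y, R x y <-> exists s, b s x y = true.

Lemma comp_enum_enumerated R : comp_enum R -> exists b, enumerated R b.
Proof.
intros [c Hc].
exists (fun s x y => existsb (fun q => eqc (fst q, fst (snd q)) (gn c, [x; y])) (Tab s)).
split; [eff|split].
- intros s t x y Hst. rewrite !existsb_exists. intros (q & Hq & E). exists q. split; [|exact E].
  now apply (Tab_mono s).
- intros x y. rewrite Hc. split.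
  + intros [z Hz]. destruct (tabulated_eval _ _ _ Hz) as [s Hs]. exists s.
    apply existsb_exists. eexists. split; [now apply Hs|]. apply eqc_refl.
  + intros [s Hs]. apply existsb_exists in Hs as ([d [v w]] & Hq & E).
    rewrite eqc_true in E. injection E as -> ->. apply Tab_eval in Hq as (z & _ & Hz). now exists z.
Qed.

Lemma enumerated_eventually R b x y : enumerated R b -> R x y
  -> eventually (fun s => b s x y = true).
Proof.
intros (_ & Hm & H) Hr. apply H in Hr as [s Hs]. exists s. intros t Ht. now apply (Hm s).
Qed.

(** * Merge histories and coding locations *)

(* [rep h x] is the representative of [x] after the merges [h], newest first. As merges send
   classes with an even element only to such classes, [rep h x] is even exactly when the class
   of [x] contains an even number. *)
Definition rep (h : list (nat * nat)) (x : nat) : nat :=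
  fold_right (fun pq r => if r =? fst pq then snd pq else r) x h.

(** Merging is directed: the class of [x] takes over the representative of [y]. *)
Definition merge (x y : nat) (h : list (nat * nat)) : list (nat * nat) := (rep h x, rep h y) :: h.

Lemma rep_merge p q h x : rep (merge p q h) x = if rep h x =? rep h p then rep h q else rep h x.
Proof. reflexivity. Qed.

Lemma rep_merge_neq p q h x : rep h x <> rep h p -> rep (merge p q h) x = rep h x.
Proof. intro H. rewrite rep_merge. now destruct (Nat.eqb_spec (rep h x) (rep h p)). Qed.

Lemma merge_mono p q h x y : rep h x = rep h y -> rep (merge p q h) x = rep (merge p q h) y.
Proof. intro H. now rewrite !rep_merge, H. Qed.

Lemma merge_merges p q h : rep (merge p q h) p = rep (merge p q h) q.
Proof. rewrite !rep_merge, Nat.eqb_refl. now destruct (_ =? _). Qed.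

Lemma effective_rep : effective2 rep.
Proof. unfold rep. eff. Qed.
#[export] Hint Resolve effective_rep : eff.

Lemma effective_merge : effective3 merge.
Proof. unfold merge. eff. Qed.
#[export] Hint Resolve effective_merge : eff.

(* The second component of a state lists the active coding locations: an entry [(n, (i, c))]
   says that strategy [n] copies the element [i] of [U] to [c]. *)
Definition entry : Type := nat * (nat * nat).
Definition state : Type := list (nat * nat) * list entry.

(** New entries go to the front, so the indices copied by one strategy, read along the list, count
    down to 0. *)
Fixpoint downfrom (n : nat) : list nat :=
  match n with
  | 0 => []
  | S m => m :: downfrom m
  end.

Lemma in_downfrom n i : i < n -> In i (downfrom n).
Proof.
induction n as [|n IH]; [lia|]. intro Hi. destruct (Nat.eq_dec n i); [now left|].
right. apply IH. lia.
Qed.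

Definition entries_of (n : nat) (cs : list entry) : list entry := filter (fun a => fst a =? n) cs.

Lemma in_entries_of n cs a : In a (entries_of n cs) <-> In a cs /\ fst a = n.
Proof. unfold entries_of. now rewrite filter_In, Nat.eqb_eq. Qed.

(** This is the injury: when the requirement of priority [m] acts, all strategies numbered above [m]
    lose their locations. *)
Definition keep_upto (m : nat) (cs : list entry) : list entry := filter (fun a => fst a <=? m) cs.

Lemma in_keep_upto m cs a : In a (keep_upto m cs) <-> In a cs /\ fst a <= m.
Proof. unfold keep_upto. now rewrite filter_In, Nat.leb_le. Qed.

Lemma entries_of_keep_upto n m cs :
  entries_of n (keep_upto m cs) = if n <=? m then entries_of n cs else [].
Proof.
unfold entries_of, keep_upto. induction cs as [|a cs IH]; simpl; [now destruct (_ <=? _)|].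
destruct (Nat.leb_spec (fst a) m), (Nat.eqb_spec (fst a) n); simpl; rewrite ?IH;
  destruct (Nat.leb_spec n m), (Nat.eqb_spec (fst a) n); try reflexivity; lia.
Qed.

Lemma effective_entries_of : effective2 entries_of.
Proof. unfold entries_of. eff. Qed.
#[export] Hint Resolve effective_entries_of : eff.

Lemma effective_keep_upto : effective2 keep_upto.
Proof. unfold keep_upto. eff. Qed.
#[export] Hint Resolve effective_keep_upto : eff.

Definition entry_of_nat (n : nat) : entry := (fst (of_nat n), of_nat (snd (of_nat n))).

Lemma entry_of_nat_surj a : exists n, entry_of_nat n = a.
Proof.
destruct a as [n [i c]]. exists (to_nat (n, to_nat (i, c))). unfold entry_of_nat.
rewrite cancel_of_to. cbn [fst snd]. now rewrite cancel_of_to.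
Qed.

Lemma effective_entry_of_nat : effective entry_of_nat.
Proof. unfold entry_of_nat. eff. Qed.
#[export] Hint Resolve effective_entry_of_nat : eff.

(** * The construction *)

Section Construction.

Variables (A B U : relation nat) (Ab Bb Ub : nat -> nat -> nat -> bool).
Hypothesis A_equiv : equivalence nat A.
Hypothesis U_equiv : equivalence nat U.
Hypothesis A_enum : enumerated A Ab.
Hypothesis B_enum : enumerated B Bb.
Hypothesis U_enum : enumerated U Ub.
Hypothesis U_B : ~ reducible U B.

Let Ab_eff : effective3 Ab := proj1 A_enum.
Let Bb_eff : effective3 Bb := proj1 B_enum.
Let Ub_eff : effective3 Ub := proj1 U_enum.

Definition coding (s r : nat) (st : state) : state :=
  if Ab s (fst (of_nat r)) (snd (of_nat r))
  then (merge (2 * fst (of_nat r)) (2 * snd (of_nat r)) (fst st), snd st) else st.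

Definition in_range (s e x : nat) : bool :=
  existsb (fun p => (fst p =? e) && (length (fst (snd p)) =? 1) && eqc (snd (snd p)) [x]) (Tab s).

(* The number [e] is the index of a function whose range is to meet the class of [j], [x] is
   a value of that function, and the priority is [m = to_nat (e, j)]. *)
Definition fires (s m x : nat) (st : state) : bool :=
  let e := fst (of_nat m) in
  let j := snd (of_nat m) in
  (x <=? s) && (j <=? s) && in_range s e x && Nat.odd (rep (fst st) x) &&
  forallb (fun a => negb (fst a <=? m) || negb (rep (fst st) (snd (snd a)) =? rep (fst st) x))
    (snd st) &&
  forallb (fun p => negb ((fst p =? e) && (length (fst (snd p)) =? 1)) ||
    negb (rep (fst st) (hd 0 (snd (snd p))) =? rep (fst st) j)) (Tab s).

(** The value [x] is given up to the class of [j] only if its class contains no even number and no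
    location of a strategy up to [m], and if no known value of the function lies in the class of [j]
    yet. *)
Definition collecting (s r : nat) (st : state) : state :=
  let m := fst (of_nat r) in
  let x := snd (of_nat r) in
  if fires s m x st then (merge x (snd (of_nat m)) (fst st), keep_upto m (snd st)) else st.

(** Keeps the copy of [U] faithful: two locations of one strategy are merged once their indices are
    seen to be related. *)
Definition copying (s r : nat) (st : state) : state :=
  let a := entry_of_nat (fst (of_nat r)) in
  let b := entry_of_nat (snd (of_nat r)) in
  if mem a (snd st) && mem b (snd st) && (fst a =? fst b) && Ub s (fst (snd a)) (fst (snd b))
  then (merge (snd (snd a)) (snd (snd b)) (fst st), snd st) else st.

Definition pair_agrees (s n : nat) (a b : entry) : bool :=
  existsb (fun p => eqc (fst p, fst (snd p)) (n, [snd (snd a)]) &&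
    existsb (fun q => eqc (fst q, fst (snd q)) (n, [snd (snd b)]) &&
      eqc (Bb s (hd 0 (snd (snd p))) (hd 0 (snd (snd q)))) (Ub s (fst (snd a)) (fst (snd b))))
    (Tab s)) (Tab s).

(** As far as stage [s] can tell, the function with number [n] reduces the part of [U] copied so far
    to [B]. An empty list agrees vacuously, so every strategy gets a first location. *)
Definition agrees (s n : nat) (cs : list entry) : bool :=
  forallb (fun a => forallb (fun b => pair_agrees s n a b) (entries_of n cs)) (entries_of n cs).

(** The stage supplies a fresh odd number, and the length of the list is the first index not yet
    copied. *)
Definition new_entry (s n : nat) (cs : list entry) : entry :=
  (n, (length (entries_of n cs), 2 * s + 1)).

Definition diagonalizing (s n : nat) (st : state) : state :=
  if agrees s n (snd st) then (fst st, new_entry s n (snd st) :: snd st) else st.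

Definition step (s : nat) (st : state) : state :=
  let k := fst (of_nat (proposal s)) in
  let r := snd (of_nat (proposal s)) in
  if k =? 0 then coding s r st else
  if k =? 1 then collecting s r st else
  if k =? 2 then copying s r st else diagonalizing s r st.

Definition stage (s : nat) : state := nat_rect (fun _ => state) ([], []) step s.

Lemma effective_stage : effective stage.
Proof.
unfold stage, step, coding, collecting, fires, in_range, copying, diagonalizing, agrees,
  pair_agrees, new_entry.
cbv zeta. unfold state. eff.
Qed.

Lemma stage_S s : stage (S s) = step s (stage s).
Proof. reflexivity. Qed.

(** * Invariants of the stages *)

(** The numbers that a merge at stage [s] may involve; all others are still fresh at stage [S s]. *)
Definition settled (s x : nat) : Prop := Nat.even x = true \/ x <= 2 * s + 1.

(** Even representatives mark exactly the classes with an even number, even numbers are identified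
    only on account of [A], and large odd numbers are untouched. *)
Record classes_inv (s : nat) (h : list (nat * nat)) : Prop := {
  even_rep : forall a, Nat.even (rep h (2 * a)) = true;
  rep_even : forall x, Nat.even (rep h x) = true -> exists a, rep h (2 * a) = rep h x;
  rep_coding : forall a b, rep h (2 * a) = rep h (2 * b) -> A a b;
  rep_fresh : forall x y, Nat.odd y = true -> 2 * s + 1 <= y -> rep h x = y -> x = y;
  fresh_rep : forall y, Nat.odd y = true -> 2 * s + 1 <= y -> rep h y = y }.

(** Locations lie outside the even classes, different strategies share no class, and one strategy
    identifies locations only on account of [U]. *)
Record entries_inv (s : nat) (h : list (nat * nat)) (cs : list entry) : Prop := {
  entry_odd : forall a, In a cs -> Nat.odd (rep h (snd (snd a))) = true;
  entry_bound : forall a, In a cs -> snd (snd a) <= 2 * s;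
  entry_sep : forall a b, In a cs -> In b cs ->
    rep h (snd (snd a)) = rep h (snd (snd b)) -> fst a = fst b /\ U (fst (snd a)) (fst (snd b));
  entry_index : forall n,
    map (fun a => fst (snd a)) (entries_of n cs) = downfrom (length (entries_of n cs)) }.

Lemma classes_inv_S s h : classes_inv s h -> classes_inv (S s) h.
Proof.
intros []. constructor; trivial.
- intros x y Hy Hs. apply rep_fresh0; [trivial|lia].
- intros y Hy Hs. apply fresh_rep0; [trivial|lia].
Qed.

(** A class with an even number may be redirected only by an instance of the coding of [A]; an odd
    class may be redirected anywhere. *)
Lemma classes_inv_merge s h p q :
  classes_inv s h -> settled s p -> settled s q ->
  (Nat.even (rep h p) = true -> exists a b, p = 2 * a /\ q = 2 * b /\ A a b) ->
  classes_inv (S s) (merge p q h).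
Proof.
intros [He Hre Hc Hf Hfr] Hp Hq Hpq.
assert (Hpq' : Nat.even (rep h p) = true -> Nat.even (rep h q) = true).
{ intros (a & b & -> & -> & _)%Hpq. apply He. }
assert (Hfresh : forall y, Nat.odd y = true -> 2 * S s + 1 <= y -> ~ settled s y).
{ intros y Hy Hs [Hev|Hle]; [|lia]. rewrite <- Nat.negb_even, Hev in Hy. discriminate. }
constructor.
- intro a. rewrite rep_merge. destruct (Nat.eqb_spec (rep h (2 * a)) (rep h p)) as [e|];
  [|apply He].
  apply Hpq'. rewrite <- e. apply He.
- intro x. rewrite rep_merge. destruct (Nat.eqb_spec (rep h x) (rep h p)) as [e|ne]; intro Hx.
  + destruct (Hre q Hx) as [a Ha]. exists a. rewrite rep_merge, Ha. now destruct (_ =? _).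
  + destruct (Hre x Hx) as [a Ha]. exists a. now rewrite rep_merge_neq; rewrite Ha.
- intros a b. rewrite !rep_merge. destruct A_equiv as [Arefl Atrans Asym].
  destruct (Nat.eqb_spec (rep h (2 * a)) (rep h p)) as [e|ne],
    (Nat.eqb_spec (rep h (2 * b)) (rep h p)) as [e'|ne']; intro H.
  + apply Hc. congruence.
  + destruct Hpq as (p' & q' & -> & -> & Hpq); [rewrite <- e; apply He|].
    apply (Atrans a p'); [now apply Hc|]. apply (Atrans p' q'); [trivial|]. now apply Hc.
  + destruct Hpq as (p' & q' & -> & -> & Hpq); [rewrite <- e'; apply He|].
    apply (Atrans a q'); [now apply Hc|]. apply (Atrans q' p'); [now apply Asym|]. now apply Hc.
  + now apply Hc.
- intros x y Hy Hs. rewrite rep_merge. destruct (Nat.eqb_spec (rep h x) (rep h p)) as [e|ne];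
  intro H.
  + destruct (Hfresh y Hy Hs). rewrite <- (Hf q y Hy); [trivial|lia|trivial].
  + apply Hf; [trivial|lia|trivial].
- intros y Hy Hs. assert (Hry : rep h y = y) by (apply Hfr; [trivial|lia]).
  rewrite rep_merge_neq; [trivial|]. rewrite Hry. intro H.
  apply (Hfresh y Hy Hs). rewrite <- (Hf p y Hy); [trivial|lia|easy].
Qed.

Lemma entries_inv_S s h cs : entries_inv s h cs -> entries_inv (S s) h cs.
Proof. intros []. constructor; trivial. intros a Ha. specialize (entry_bound0 a Ha). lia. Qed.

(** Only the class of [p] changes its representative, so locations in the class of [q] are
    allowed. *)
Lemma entries_inv_merge s h cs p q :
  entries_inv s h cs -> (forall a, In a cs -> rep h (snd (snd a)) <> rep h p) ->
  entries_inv s (merge p q h) cs.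
Proof.
intros [] Hp. constructor; trivial.
- intros a Ha. rewrite rep_merge_neq; auto.
- intros a b Ha Hb. rewrite !rep_merge_neq; auto.
Qed.

Lemma even_odd_false x y : Nat.even x = true -> Nat.odd y = true -> x <> y.
Proof. intros Hx Hy <-. rewrite <- Nat.negb_even, Hx in Hy. discriminate. Qed.

Lemma odd_not_even x : Nat.odd x = true -> Nat.even x = true -> False.
Proof. intros Hx Hy. now apply (even_odd_false x x). Qed.

Definition stage_inv (s : nat) (st : state) : Prop :=
  classes_inv s (fst st) /\ entries_inv s (fst st) (snd st).

Lemma stage_inv_S s st : stage_inv s st -> stage_inv (S s) st.
Proof. intros []. split; [now apply classes_inv_S|now apply entries_inv_S]. Qed.

Lemma coding_inv s r st : stage_inv s st -> stage_inv (S s) (coding s r st).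
Proof.
intros Hst. unfold coding. destruct (Ab _ _ _) eqn:E; [|now apply stage_inv_S].
destruct Hst as [Hc He]. split; cbn [fst snd].
- apply classes_inv_merge; trivial.
  + left. apply Nat.even_even.
  + left. apply Nat.even_even.
  + intros _. do 2 eexists. split; [reflexivity|split; [reflexivity|]]. apply A_enum. eauto.
- apply entries_inv_merge; [now apply entries_inv_S|]. intros a Ha e.
  apply (odd_not_even (rep (fst st) (snd (snd a)))); [now apply He|]. rewrite e. apply Hc.
Qed.

Lemma fires_spec s m x st : fires s m x st = true ->
  x <= s /\ snd (of_nat m) <= s /\ Nat.odd (rep (fst st) x) = true /\
  (exists z, In (fst (of_nat m), ([z], [x])) (Tab s)) /\
  (forall a, In a (snd st) -> fst a <= m -> rep (fst st) (snd (snd a)) <> rep (fst st) x) /\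
  (forall z y, In (fst (of_nat m), ([z], [y])) (Tab s)
    -> rep (fst st) y <> rep (fst st) (snd (of_nat m))).
Proof.
intro H. unfold fires in H. bools. repeat split; trivial.
- apply existsb_exists in H3 as ([e [v w]] & Hq & E). cbn [fst snd] in E. bools. subst.
  destruct v as [|z [|z' v]]; try discriminate. now exists z.
- intros a Ha Hm. rewrite forallb_forall in H1. specialize (H1 a Ha).
  apply Nat.leb_le in Hm. rewrite Hm in H1. simpl in H1. now bools.
- intros z y Hq. rewrite forallb_forall in H0. specialize (H0 _ Hq). cbn [fst snd length hd] in H0.
  rewrite !Nat.eqb_refl in H0. simpl in H0. now bools.
Qed.

(** The class of [x] avoids the locations of strategies up to [m], and the other locations are
    dropped. *)
Lemma collecting_inv s r st : stage_inv s st -> stage_inv (S s) (collecting s r st).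
Proof.
intros Hst. unfold collecting. destruct (fires _ _ _ _) eqn:E; [|now apply stage_inv_S].
apply fires_spec in E as (Hx & Hj & Hodd & _ & Hfree & _).
destruct Hst as [Hc He]. split; cbn [fst snd].
- apply classes_inv_merge; trivial.
  + right. lia.
  + right. lia.
  + intro H. now destruct (odd_not_even _ Hodd H).
- apply entries_inv_merge.
  + apply entries_inv_S. destruct He. constructor.
    * intros a [Ha _]%in_keep_upto. auto.
    * intros a [Ha _]%in_keep_upto. auto.
    * intros a b [Ha _]%in_keep_upto [Hb _]%in_keep_upto. auto.
    * intro n. rewrite entries_of_keep_upto. destruct (_ <=? _); [apply entry_index0|reflexivity].
  + intros a [Ha Hm]%in_keep_upto. auto.
Qed.

Lemma copying_inv s r st : stage_inv s st -> stage_inv (S s) (copying s r st).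
Proof.
intros Hst. unfold copying.
set (a := entry_of_nat _). set (b := entry_of_nat _).
destruct (_ && _) eqn:E; [|now apply stage_inv_S].
apply andb_prop in E as [[[Ha Hb]%andb_prop Hk]%andb_prop Hu]. bools.
destruct Hst as [Hc He]. split; cbn [fst snd].
- apply classes_inv_merge; trivial.
  + right. apply (entry_bound _ _ _ He) in Ha. lia.
  + right. apply (entry_bound _ _ _ He) in Hb. lia.
  + intro H'. now destruct (odd_not_even _ (entry_odd _ _ _ He _ Ha) H').
- apply entries_inv_S. assert (HU : U (fst (snd a)) (fst (snd b))) by (apply U_enum; eauto).
  destruct U_equiv as [Urefl Utrans Usym]. destruct He as [Ho Hbd Hs Hi].
  (* A location either moves to the class of [b], and then belongs to the same strategy and has an
     index related to that of [b], or keeps its representative. *)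
  assert (Hmerge : forall d, In d (snd st) ->
    (rep (merge (snd (snd a)) (snd (snd b)) (fst st)) (snd (snd d)) = rep (fst st) (snd (snd b)) /\
     fst d = fst a /\ U (fst (snd d)) (fst (snd b))) \/
    rep (merge (snd (snd a)) (snd (snd b)) (fst st)) (snd (snd d)) = rep (fst st) (snd (snd d))).
  { intros d Hd. rewrite rep_merge. destruct (Nat.eqb_spec (rep (fst st) (snd (snd d))) (rep (fst
    st) (snd (snd a)))) as [e|]; [|now right].
    left. split; [trivial|]. destruct (Hs d a Hd Ha e) as [Hk' Hu']. split; [trivial|]. eauto. }
  constructor; trivial.
  + intros d Hd. destruct (Hmerge d Hd) as [[-> _]| ->]; auto.
  + intros c d Hc' Hd. destruct (Hmerge c Hc') as [(-> & Hk1 & Hu1)| ->], (Hmerge d Hd)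
    as [(-> & Hk2 & Hu2)| ->]; intro e.
    * split; [congruence|]. eauto.
    * destruct (Hs b d Hb Hd e). split; [congruence|]. eauto.
    * destruct (Hs c b Hc' Hb e). split; [congruence|]. eauto.
    * now apply Hs.
Qed.

Lemma diagonalizing_inv s n st : stage_inv s st -> stage_inv (S s) (diagonalizing s n st).
Proof.
intros Hst. unfold diagonalizing. destruct (agrees _ _ _); [|now apply stage_inv_S].
destruct Hst as [Hc He]. split; cbn [fst snd]; [now apply classes_inv_S|].
assert (Hrep : rep (fst st) (2 * s + 1) = 2 * s + 1).
{ apply (fresh_rep _ _ Hc); [apply Nat.odd_odd|lia]. }
assert (Hnew : forall a, In a (snd st) -> rep (fst st) (snd (snd a)) <> 2 * s + 1).
{ intros a Ha e. apply (rep_fresh _ _ Hc) in e; [|apply Nat.odd_odd|lia].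
  apply (entry_bound _ _ _ He) in Ha. lia. }
destruct U_equiv as [Urefl _ _]. destruct He as [Ho Hb Hs Hi]. constructor.
- intros a [<-|Ha]; [|auto]. cbn [new_entry snd]. rewrite Hrep. apply Nat.odd_odd.
- intros a [<-|Ha]; [cbn [new_entry snd]; lia|]. specialize (Hb a Ha). lia.
- intros a b [<-|Ha] [<-|Hb']; cbn [new_entry fst snd]; rewrite ?Hrep; intro e.
  + split; [reflexivity|apply Urefl].
  + now destruct (Hnew b Hb').
  + now destruct (Hnew a Ha).
  + now apply Hs.
- intro k. unfold entries_of. cbn [filter new_entry fst]. destruct (Nat.eqb_spec n k) as [->|];
  [|apply Hi].
  cbn [map length downfrom fst snd]. f_equal. apply Hi.
Qed.

Lemma stage_invariant s : stage_inv s (stage s).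
Proof.
induction s as [|s IH].
- split; constructor; try easy; cbn [stage nat_rect fst rep fold_right].
  + apply Nat.even_even.
  + intros x Hx. apply Nat.even_spec in Hx as [a ->]. now exists a.
  + intros a b e. replace b with a by lia. apply A_equiv.
- rewrite stage_S. unfold step.
  destruct (_ =? 0); [now apply coding_inv|]. destruct (_ =? 1); [now apply collecting_inv|].
  destruct (_ =? 2); [now apply copying_inv|now apply diagonalizing_inv].
Qed.

(** * The limit relation *)

Definition limit_rel (x y : nat) : Prop :=
  exists s, (rep (fst (stage s)) x =? rep (fst (stage s)) y) = true.

Lemma step_hist_mono s st x y :
  rep (fst st) x = rep (fst st) y -> rep (fst (step s st)) x = rep (fst (step s st)) y.
Proof.
intro H. unfold step, coding, collecting, copying, diagonalizing.
repeat match goal with |- context [if ?b then _ else _] => destruct b end;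
  cbn [fst]; trivial; now apply merge_mono.
Qed.

Lemma stage_mono s t x y : s <= t ->
  rep (fst (stage s)) x = rep (fst (stage s)) y -> rep (fst (stage t)) x = rep (fst (stage t)) y.
Proof.
induction 1 as [|t _ IH]; [trivial|]. intro H. rewrite stage_S. apply step_hist_mono; auto.
Qed.

Lemma limit_rel_intro s x y : rep (fst (stage s)) x = rep (fst (stage s)) y -> limit_rel x y.
Proof. intro H. exists s. now apply Nat.eqb_eq. Qed.

Lemma limit_rel_eventually x y :
  limit_rel x y -> eventually (fun s => rep (fst (stage s)) x = rep (fst (stage s)) y).
Proof. intros [s H%Nat.eqb_eq]. exists s. intros t Ht. now apply (stage_mono s). Qed.

Lemma limit_rel_equiv : equivalence nat limit_rel.
Proof.
split.
- intro x. now apply (limit_rel_intro 0).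
- intros x y z Hxy%limit_rel_eventually Hyz%limit_rel_eventually.
  destruct (eventually_and _ _ Hxy Hyz) as [s Hs]. destruct (Hs s (le_n s)).
  apply (limit_rel_intro s). congruence.
- intros x y [s H%Nat.eqb_eq]. now apply (limit_rel_intro s).
Qed.

Lemma limit_rel_ceer : ceer limit_rel.
Proof.
split; [apply limit_rel_equiv|].
apply (comp_enum_exists (fun s x y => rep (fst (stage s)) x =? rep (fst (stage s)) y)).
assert (Hs := effective_stage). unfold state in Hs. eff.
Qed.

Lemma step_coding s r : proposal s = to_nat (0, r) -> stage (S s) = coding s r (stage s).
Proof. intro H. rewrite stage_S. unfold step. now rewrite H, cancel_of_to. Qed.

Lemma step_collecting s r : proposal s = to_nat (1, r) -> stage (S s) = collecting s r (stage s).
Proof. intro H. rewrite stage_S. unfold step. now rewrite H, cancel_of_to. Qed.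

Lemma step_copying s r : proposal s = to_nat (2, r) -> stage (S s) = copying s r (stage s).
Proof. intro H. rewrite stage_S. unfold step. now rewrite H, cancel_of_to. Qed.

Lemma step_diagonalizing s r : proposal s = to_nat (3, r)
  -> stage (S s) = diagonalizing s r (stage s).
Proof. intro H. rewrite stage_S. unfold step. now rewrite H, cancel_of_to. Qed.

Lemma limit_rel_coding a b : limit_rel (2 * a) (2 * b) <-> A a b.
Proof.
split.
- intros [s H%Nat.eqb_eq]. now apply (rep_coding _ _ (proj1 (stage_invariant s))).
- intro Hab. destruct (enumerated_eventually _ _ _ _ A_enum Hab) as [s0 Hs0].
  destruct (proposal_recurs (to_nat (0, to_nat (a, b))) s0) as (s & Hs & Hp).
  apply (limit_rel_intro (S s)). rewrite (step_coding _ _ Hp). unfold coding.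
  rewrite cancel_of_to. cbn [fst snd]. rewrite (Hs0 s Hs). cbn [fst]. apply merge_merges.
Qed.

Definition outside (x : nat) : Prop := forall a, ~ limit_rel x (2 * a).

Lemma outside_odd s x : outside x -> Nat.odd (rep (fst (stage s)) x) = true.
Proof.
intro Hx. rewrite <- Nat.negb_even. apply Bool.negb_true_iff, Bool.not_true_is_false.
intros [a Ha]%(rep_even _ _ (proj1 (stage_invariant s))).
apply (Hx a). now apply (limit_rel_intro s).
Qed.

(** * Finite injury: every strategy settles *)

Definition acts (m s : nat) : Prop :=
  exists x, proposal s = to_nat (1, to_nat (m, x)) /\ fires s m x (stage s) = true.

Lemma stage_cases s :
  snd (stage (S s)) = snd (stage s) \/
  (exists m, acts m s /\ snd (stage (S s)) = keep_upto m (snd (stage s))) \/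
  (exists n, agrees s n (snd (stage s)) = true /\
     snd (stage (S s)) = new_entry s n (snd (stage s)) :: snd (stage s)).
Proof.
assert (Hp : exists k r, proposal s = to_nat (k, r)).
{ exists (fst (of_nat (proposal s))), (snd (of_nat (proposal s))).
  now rewrite <- surjective_pairing, cancel_to_of. }
destruct Hp as (k & r & Hp). rewrite stage_S. unfold step. rewrite Hp, cancel_of_to. cbn [fst snd].
destruct (Nat.eqb_spec k 0); [|destruct (Nat.eqb_spec k 1); [|destruct (Nat.eqb_spec k 2)]].
- left. unfold coding. now destruct (Ab _ _ _).
- assert (Hr : r = to_nat (fst (of_nat r), snd (of_nat r))).
  { now rewrite <- surjective_pairing, cancel_to_of. }
  unfold collecting. destruct (fires _ _ _ _) eqn:E; [|now left].
  right; left. exists (fst (of_nat r)). split; [|reflexivity].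
  exists (snd (of_nat r)). rewrite <- Hr. split; congruence.
- left. unfold copying. now destruct (_ && _).
- unfold diagonalizing. destruct (agrees _ _ _) eqn:E; [|now left].
  right; right. now exists r.
Qed.

Lemma acts_merges m s : acts m s -> exists z x,
  In (fst (of_nat m), ([z], [x])) (Tab s) /\ limit_rel x (snd (of_nat m)) /\
  rep (fst (stage (S s))) x = rep (fst (stage (S s))) (snd (of_nat m)).
Proof.
intros (x & Hp & Hf). assert (Hs := fires_spec _ _ _ _ Hf).
destruct Hs as (_ & _ & _ & [z Hz] & _). exists z, x. split; [exact Hz|].
assert (e : rep (fst (stage (S s))) x = rep (fst (stage (S s))) (snd (of_nat m))).
{ rewrite (step_collecting _ _ Hp). unfold collecting. rewrite cancel_of_to. cbn [fst snd].
  rewrite Hf. apply merge_merges. }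
split; [|exact e]. now apply (limit_rel_intro (S s)).
Qed.

(** After the action a value of the function stays in the class of [j], so the last condition of
    [fires] fails for good. *)
Lemma acts_once m s t : acts m s -> s < t -> ~ acts m t.
Proof.
intros Hs Hlt (x' & _ & (_ & _ & _ & _ & _ & Hf)%fires_spec).
destruct (acts_merges m s Hs) as (z & x & Hz & _ & e).
apply (Hf z x); [now apply (Tab_mono s); [lia|]|]. now apply (stage_mono (S s)).
Qed.

Lemma eventually_quiet n : eventually (fun s => forall k, k < n -> ~ acts k s).
Proof.
apply (eventually_forall_below (fun k s => ~ acts k s)). intros k _.
destruct (classic (exists s, acts k s)) as [[s Hs]|H].
- exists (S s). intros t Ht. now apply (acts_once k s).
- exists 0. intros t _ Ht. apply H. now exists t.
Qed.

Definition extends (n s : nat) : Prop :=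
  agrees s n (snd (stage s)) = true /\
  entries_of n (snd (stage (S s))) = new_entry s n (snd (stage s)) :: entries_of n (snd (stage s)).

(** Strategy [n] is injured only by requirements of number below [n]. *)
Lemma entries_of_step n s : (forall k, k < n -> ~ acts k s) ->
  entries_of n (snd (stage (S s))) = entries_of n (snd (stage s)) \/ extends n s.
Proof.
intro Hq. destruct (stage_cases s) as [->|[(m & Hm & ->)|(m & Hm & e)]].
- now left.
- left. rewrite entries_of_keep_upto. destruct (Nat.leb_spec n m); [trivial|]. now destruct (Hq m).
- unfold extends. rewrite e. unfold entries_of at 1 3. cbn [filter new_entry fst].
  destruct (Nat.eqb_spec m n) as [->|]; [right|left; reflexivity]. split; [exact Hm|reflexivity].
Qed.

Lemma entries_of_grow n s t a : s <= t -> (forall u, s <= u -> forall k, k < n -> ~ acts k u) ->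
  In a (entries_of n (snd (stage s))) -> In a (entries_of n (snd (stage t))).
Proof.
intros Hle Hq. induction Hle as [|t Hle IH]; [trivial|]. intro Ha.
destruct (entries_of_step n t (Hq t Hle)) as [->|[_ ->]]; [|right]; auto.
Qed.

Lemma pair_agrees_values s n a b : pair_agrees s n a b = true ->
  exists v w, In (n, ([snd (snd a)], v)) (Tab s) /\ In (n, ([snd (snd b)], w)) (Tab s) /\
    Bb s (hd 0 v) (hd 0 w) = Ub s (fst (snd a)) (fst (snd b)).
Proof.
intro H. unfold pair_agrees in H.
apply existsb_exists in H as ([d [u v]] & Hp & H). cbn [fst snd] in H.
apply andb_prop in H as [E H]. rewrite eqc_true in E. injection E as -> ->.
apply existsb_exists in H as ([d [u w]] & Hq & H). cbn [fst snd] in H.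
apply andb_prop in H as [E H]. rewrite eqc_true in E. injection E as -> ->.
rewrite eqc_true in H. now exists v, w.
Qed.

Lemma agrees_pair s n cs a b :
  agrees s n cs = true -> In a (entries_of n cs) -> In b (entries_of n cs)
    -> pair_agrees s n a b = true.
Proof.
intros H Ha Hb. unfold agrees in H. rewrite forallb_forall in H. specialize (H a Ha).
rewrite forallb_forall in H. auto.
Qed.

(* If strategy [n] extended its list of coding locations forever, then the function of index
   [n], restricted to these locations, would reduce [U] to [B]. *)
Lemma extends_finitely n : eventually (fun s => ~ extends n s).
Proof.
apply NNPP. intro Hinf.
destruct (eventually_quiet n) as [s0 Hq].
assert (Hext : forall t, exists s, t <= s /\ extends n s).
{ intro t. apply NNPP. intro H. apply Hinf. exists t. intros s Hs He. apply H. now exists s. }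
assert (Hlen : forall i, exists s, s0 <= s /\ i < length (entries_of n (snd (stage s)))).
{ induction i as [|i (s & Hs & Hi)].
  - destruct (Hext s0) as (s & Hs & _ & He). exists (S s). split; [lia|]. rewrite He. simpl. lia.
  - destruct (Hext s) as (t & Ht & _ & He). exists (S t). split; [lia|]. rewrite He. cbn [length].
    apply -> Nat.succ_lt_mono.
    assert (Hmono : length (entries_of n (snd (stage s))) <= length (entries_of n (snd (stage t)))).
    { clear - Hq Hs Ht. induction Ht as [|t Ht IH]; [trivial|].
      destruct (entries_of_step n t) as [->|[_ ->]]; [apply Hq; lia|trivial|]. cbn [length]. lia. }
    lia. }
assert (Hentry : forall i, exists s c, s0 <= s /\ In (n, (i, c)) (entries_of n (snd (stage s)))).
{ intro i. destruct (Hlen i) as (s & Hs & Hi).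
  assert (H := in_downfrom _ _ Hi).
  rewrite <- (entry_index _ _ _ (proj2 (stage_invariant s)) n) in H.
  apply in_map_iff in H as ([k [i' c]] & Hi' & Ha). cbn [fst snd] in Hi'. subst i'.
  assert (Hk := proj2 (proj1 (in_entries_of _ _ _) Ha)). cbn [fst] in Hk. subst k.
  now exists s, c. }
(* The number [k] codes a stage, a location of index [i] at that stage, and the value of the
   function there. *)
set (b := fun k i =>
  let s := fst (of_nat k) in
  let c := fst (of_nat (snd (of_nat k))) in
  let y := snd (of_nat (snd (of_nat k))) in
  (s0 <=? s) && mem (n, (i, c)) (entries_of n (snd (stage s))) &&
  existsb (fun p => eqc (fst p, fst (snd p)) (n, [c]) && (hd 0 (snd (snd p)) =? y)) (Tab s)).
assert (Hb : forall k i, b k i = true -> exists s c v, s0 <= s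
  /\ hd 0 v = snd (of_nat (snd (of_nat k))) /\
  In (n, (i, c)) (entries_of n (snd (stage s))) /\ In (n, ([c], v)) (Tab s)).
{ intros k i H. unfold b in H. bools.
  apply existsb_exists in H0 as ([d [u v]] & Hp & E). cbn [fst snd] in E.
  apply andb_prop in E as [E Ev]. rewrite eqc_true in E. rewrite Nat.eqb_eq in Ev.
    injection E as -> ->. do 3 eexists. repeat split; eassumption. }
destruct (effective_choice b) as (f & Hf & Hbf).
{ assert (Hst := effective_stage). unfold state, entry in Hst. unfold b. cbv zeta. eff. }
{ intro i. destruct (Hentry i) as (s & c & Hs & Ha). destruct (Hext s) as (t & Ht & Hagr & _).
  apply (entries_of_grow n s t) in Ha; [|trivial|intros u Hu; apply Hq; lia].
  assert (Haa := agrees_pair _ _ _ _ _ Hagr Ha Ha).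
  apply pair_agrees_values in Haa as (v & _ & Hv & _ & _). cbn [fst snd] in Hv.
  exists (to_nat (t, to_nat (c, hd 0 v))). unfold b. cbv zeta. rewrite cancel_of_to. cbn [fst snd].
  rewrite cancel_of_to. cbn [fst snd]. rewrite !Bool.andb_true_iff. repeat split.
  - apply Nat.leb_le. lia.
  - now apply mem_In.
  - apply existsb_exists. eexists. split; [exact Hv|]. cbn [fst snd].
    now rewrite eqc_refl, Nat.eqb_refl. }
apply U_B. exists (fun i => snd (of_nat (snd (of_nat (f i))))). split;
  [apply effective_computable; eff|].
intros i j.
destruct (Hb _ _ (Hbf i)) as (s1 & c & v & Hs1 & <- & Hc & Hv).
destruct (Hb _ _ (Hbf j)) as (s2 & d & w & Hs2 & <- & Hd & Hw).
(* The two approximations agree at arbitrarily late stages; being monotone, they then agree in the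
   limit. *)
assert (Hagree : forall t, exists s, t <= s /\ Bb s (hd 0 v) (hd 0 w) = Ub s i j).
{ intro t. destruct (Hext (max t (max s1 s2))) as (s & Hs & Hagr & _). exists s. split; [lia|].
  apply (entries_of_grow n s1 s) in Hc; [|lia|intros u Hu; apply Hq; lia].
  apply (entries_of_grow n s2 s) in Hd; [|lia|intros u Hu; apply Hq; lia].
  assert (H := agrees_pair _ _ _ _ _ Hagr Hc Hd).
  apply pair_agrees_values in H as (v' & w' & Hv' & Hw' & H). cbn [fst snd] in *.
  apply (Tab_mono s1 s) in Hv; [|lia]. apply (Tab_mono s2 s) in Hw; [|lia].
  now rewrite (Tab_functional _ _ _ _ _ Hv Hv'), (Tab_functional _ _ _ _ _ Hw Hw'). }
split; intro H.
- destruct (enumerated_eventually _ _ _ _ U_enum H) as [t Ht].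
  destruct (Hagree t) as (s & Hs & e). apply B_enum. exists s. now rewrite e, Ht.
- destruct (enumerated_eventually _ _ _ _ B_enum H) as [t Ht].
  destruct (Hagree t) as (s & Hs & e). apply U_enum. exists s. now rewrite <- e, Ht.
Qed.

Lemma entries_of_stable n : exists l, eventually (fun s => entries_of n (snd (stage s)) = l).
Proof.
destruct (eventually_and _ _ (eventually_quiet n) (extends_finitely n)) as [s0 Hs0].
exists (entries_of n (snd (stage s0))), s0. induction 1 as [|s Hs IH]; [reflexivity|].
destruct (Hs0 s Hs) as [Hq He]. destruct (entries_of_step n s Hq); [congruence|easy].
Qed.

(** Otherwise the strategy would lengthen its list when it is next proposed, after that list has
    become stable. *)
Lemma not_eventually_agrees n : ~ eventually (fun s => agrees s n (snd (stage s)) = true).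
Proof.
intro Ha. destruct (entries_of_stable n) as [l Hl].
destruct (eventually_and _ _ Ha Hl) as [s0 Hs0].
destruct (proposal_recurs (to_nat (3, n)) s0) as (s & Hs & Hp).
destruct (Hs0 s Hs) as [Hagr Hl1]. destruct (Hs0 (S s)) as [_ Hl2]; [lia|].
rewrite (step_diagonalizing _ _ Hp) in Hl2. unfold diagonalizing in Hl2. rewrite Hagr in Hl2.
cbn [snd] in Hl2. unfold entries_of in Hl1, Hl2. cbn [filter new_entry fst] in Hl2.
rewrite Nat.eqb_refl, Hl1 in Hl2. apply (f_equal (@length _)) in Hl2. cbn [length] in Hl2. lia.
Qed.

(** The final list is not empty, since an empty list would agree at all late stages. *)
Lemma permanent_entry n : exists a, fst a = n /\ eventually (fun s => In a (snd (stage s))).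
Proof.
destruct (entries_of_stable n) as [[|a l] [s0 Hs0]].
- destruct (not_eventually_agrees n). exists s0. intros s Hs. unfold agrees. now rewrite (Hs0 s Hs).
- exists a.
  assert (Ha : forall s, s0 <= s -> In a (snd (stage s)) /\ fst a = n).
  { intros s Hs. apply in_entries_of. rewrite (Hs0 s Hs). now left. }
  split; [now apply (Ha s0)|]. exists s0. intros s Hs. now apply Ha.
Qed.

(** Permanent locations of different strategies are outside and inequivalent. A given number is
    equivalent to those of at most one strategy, so the locations of a late strategy avoid all of
    [L]. *)
Lemma infinitely_many_outside L : exists x, outside x /\ forall y, In y L -> ~ limit_rel x y.
Proof.
assert (Hx : forall n, exists x, outside x /\
  eventually (fun s => exists a, fst a = n /\ snd (snd a) = x /\ In a (snd (stage s)))).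
{ intro n. destruct (permanent_entry n) as (a & Hn & Ha). exists (snd (snd a)). split.
  - intros b Hb%limit_rel_eventually. destruct (eventually_and _ _ Ha Hb) as [s Hs].
    destruct (Hs s (le_n s)) as [Hin e]. destruct (stage_invariant s) as [Hc He].
    apply (odd_not_even (rep (fst (stage s)) (snd (snd a)))); [now apply He|]. rewrite e. apply Hc.
  - eapply eventually_impl; [|exact Ha]. intros s Hs. now exists a. }
assert (Hsep : forall n m x y, n <> m ->
  eventually (fun s => exists a, fst a = n /\ snd (snd a) = x /\ In a (snd (stage s))) ->
  eventually (fun s => exists a, fst a = m /\ snd (snd a) = y /\ In a (snd (stage s))) ->
  ~ limit_rel x y).
{ intros n m x y Hnm Ha Hb Hxy%limit_rel_eventually.
  destruct (eventually_and _ _ (eventually_and _ _ Ha Hb) Hxy) as [s Hs].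
  destruct (Hs s (le_n s)) as [[(a & <- & <- & Hina) (b & <- & <- & Hinb)] e].
  apply Hnm. now apply (entry_sep _ _ _ (proj2 (stage_invariant s))). }
destruct (eventually_Forall (fun y n => forall x,
  eventually (fun s => exists a, fst a = n /\ snd (snd a) = x /\ In a (snd (stage s))) ->
  ~ limit_rel x y) L) as [n Hn].
{ intros y _. apply NNPP. intro H.
  assert (Hbad : forall n0, exists n x, n0 <= n /\
    eventually (fun s => exists a, fst a = n /\ snd (snd a) = x /\ In a (snd (stage s)))
      /\ limit_rel x y).
  { intro n0. apply NNPP. intro H0. apply H. exists n0. intros n Hn x Hxn Hxy. apply H0.
    now exists n, x. }
  destruct (Hbad 0) as (n & x & _ & Hn & Hxy), (Hbad (S n)) as (n' & x' & Hlt & Hn' & Hxy').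
  apply (Hsep n n' x x'); trivial; [lia|].
  destruct limit_rel_equiv as [_ Htrans Hsym]. eauto. }
destruct (Hx n) as (x & Hout & Hev). exists x. split; [trivial|]. intros y Hy.
  now apply (Hn n (le_n n)).
Qed.

(** The strategies up to [m] have finitely many final locations [L]. Some value [f z] is outside and
    avoids [L], so if the class of [j] were never met, the request for [f z] would fire at a late
    stage and meet it. *)
Lemma large_range_meets_all f :
  computable f ->
  (forall L, exists x, outside (f x) /\ forall y, In y L -> ~ limit_rel (f x) y) ->
  forall j, exists x, limit_rel (f x) j.
Proof.
intros [c Hc] Hlarge j. apply NNPP. intro Hno.
set (m := to_nat (gn c, j)).
assert (Hstable : exists L, eventually (fun s => forall a, In a (snd (stage s)) -> fst a <= m
  -> In (snd (snd a)) L)).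
{ assert (H : forall n, exists L, eventually (fun s => forall a, In a (snd (stage s))
  -> fst a < n -> In (snd (snd a)) L)).
  { induction n as [|n [L HL]]; [exists [], 0; intros; lia|].
    destruct (entries_of_stable n) as [l Hl]. exists (map (fun a => snd (snd a)) l ++ L).
    eapply eventually_impl; [|exact (eventually_and _ _ HL Hl)]. intros s [HLs Hls] a Ha Hlt.
    apply in_or_app. destruct (Nat.eq_dec (fst a) n) as [e|].
    - left. apply in_map_iff. exists a. split; [reflexivity|]. rewrite <- Hls.
      now apply in_entries_of.
    - right. apply HLs; [trivial|lia]. }
  destruct (H (S m)) as [L HL]. exists L. eapply eventually_impl; [|exact HL].
  intros s Hs a Ha Hm. apply Hs; [trivial|lia]. }
destruct Hstable as [L HL]. destruct (Hlarge L) as (z & Hout & HzL).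
destruct (eventually_and _ _ HL (tabulated_eval _ _ _ (Hc z))) as [s0 Hs0].
destruct (proposal_recurs (to_nat (1, to_nat (m, f z))) (max s0 (max (f z) j))) as (s & Hs & Hp).
destruct (Hs0 s) as [HLs Hz]; [lia|].
apply Hno. exists z. apply (limit_rel_intro (S s)). rewrite (step_collecting _ _ Hp).
unfold collecting. rewrite cancel_of_to. cbn [fst snd].
assert (Hf : fires s m (f z) (stage s) = true).
{ unfold fires, m. rewrite cancel_of_to. cbn [fst snd]. fold m. rewrite !Bool.andb_true_iff.
  repeat split.
  - apply Nat.leb_le. lia.
  - apply Nat.leb_le. lia.
  - apply existsb_exists. eexists. split; [exact Hz|]. cbn [fst snd length].
    now rewrite Nat.eqb_refl, eqc_refl.
  - now apply outside_odd.
  - apply forallb_forall. intros a Ha. destruct (Nat.leb_spec (fst a) m) as [Hm|]; [|reflexivity].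
    apply Bool.negb_true_iff, Nat.eqb_neq. intro e. apply (HzL _ (HLs a Ha Hm)).
    now apply (limit_rel_intro s).
  - apply forallb_forall. intros [e [v w]] Hq. cbn [fst snd].
    destruct (Nat.eqb_spec e (gn c)) as [->|]; [|reflexivity].
    destruct (Nat.eqb_spec (length v) 1) as [Hv|]; [|reflexivity].
    apply Bool.negb_true_iff, Nat.eqb_neq. intro E.
    destruct v as [|x [|]]; try discriminate Hv.
    apply Tab_eval in Hq as (y & -> & Hy). cbn [hd] in E.
    apply Hno. exists x. rewrite (eval_functional _ _ _ _ (Hc x) Hy).
      now apply (limit_rel_intro s). }
rewrite Hf. cbn [fst]. replace (snd (of_nat m)) with j by (unfold m; now rewrite cancel_of_to).
apply merge_merges.
Qed.

(** On the final locations of the strategy for the code of [f] the limit relation is an exact copy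
    of [U]. A reduction [f] to [B] would thus make them agree at all late stages. *)
Lemma limit_rel_not_reducible : ~ reducible limit_rel B.
Proof.
intros (f & [c Hc] & Hf).
destruct (entries_of_stable (gn c)) as [l Hl].
apply (not_eventually_agrees (gn c)).
assert (Hin : forall a, In a l -> eventually (fun s => In a (snd (stage s)))).
{ intros a Ha. eapply eventually_impl; [|exact Hl]. intros s <-. now apply in_entries_of in Ha. }
assert (Hfst : forall a, In a l -> fst a = gn c).
{ destruct Hl as [s0 Hs0]. rewrite <- (Hs0 s0 (le_n s0)). now intros a [_ Ha]%in_entries_of. }
assert (HU : forall a b, In a l -> In b l ->
  (B (f (snd (snd a))) (f (snd (snd b))) <-> U (fst (snd a)) (fst (snd b)))).
{ intros a b Ha Hb. rewrite <- Hf. split; intro H.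
  - apply limit_rel_eventually in H.
    destruct (eventually_and _ _ (eventually_and _ _ (Hin a Ha) (Hin b Hb)) H) as [s Hs].
    destruct (Hs s (le_n s)) as [[Ha' Hb'] e].
    now apply (entry_sep _ _ _ (proj2 (stage_invariant s)) a b Ha' Hb').
  - destruct (eventually_and _ _ (eventually_and _ _ (Hin a Ha) (Hin b Hb))
      (enumerated_eventually _ _ _ _ U_enum H)) as [s0 Hs0].
    destruct (entry_of_nat_surj a) as [na Hna], (entry_of_nat_surj b) as [nb Hnb].
    destruct (proposal_recurs (to_nat (2, to_nat (na, nb))) s0) as (s & Hs & Hp).
    destruct (Hs0 s Hs) as [[Ha' Hb'] Hu].
    apply (limit_rel_intro (S s)). rewrite (step_copying _ _ Hp). unfold copying.
    rewrite cancel_of_to. cbn [fst snd]. rewrite Hna, Hnb.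
    rewrite (proj2 (mem_In a _) Ha'), (proj2 (mem_In b _) Hb'), (Hfst a Ha), (Hfst b Hb),
      Nat.eqb_refl, Hu.
    cbn [andb fst]. apply merge_merges. }
(* Every single value of a monotone approximation becomes constant, with the correct limit. *)
assert (Hdec : forall R b x y, enumerated R b -> exists v : bool,
  eventually (fun s => b s x y = v) /\ (R x y <-> v = true)).
{ intros R b x y Hb. destruct (classic (R x y)) as [H|H].
  - exists true. split; [now apply (enumerated_eventually R)|easy].
  - exists false. split; [|easy]. exists 0. intros s _. apply Bool.not_true_is_false. intro E.
    apply H, Hb. now exists s. }
assert (Hpair : forall a, In a l -> eventually (fun s => forall b, In b l
  -> pair_agrees s (gn c) a b = true)).
{ intros a Ha. apply (eventually_Forall (fun b s => pair_agrees s (gn c) a b = true)). intros b Hb.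
  destruct (Hdec B Bb (f (snd (snd a))) (f (snd (snd b))) B_enum) as (v & Hv & HBv).
  destruct (Hdec U Ub (fst (snd a)) (fst (snd b)) U_enum) as (w & Hw & HUw).
  assert (e : v = w).
  { apply Bool.eq_true_iff_eq. rewrite <- HBv, <- HUw. auto. }
  destruct (eventually_and _ _ (eventually_and _ _ Hv Hw)
    (eventually_and _ _ (tabulated_eval _ _ _ (Hc (snd (snd a)))) (tabulated_eval _ _ _ (Hc (snd
      (snd b))))))
    as [s0 Hs0].
  exists s0. intros s Hs. destruct (Hs0 s Hs) as [[HBs HUs] [Hta Htb]].
  unfold pair_agrees. apply existsb_exists. eexists. split; [exact Hta|]. cbn [fst snd].
  rewrite eqc_refl. apply existsb_exists. eexists. split; [exact Htb|]. cbn [fst snd hd].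
  rewrite eqc_refl, HBs, HUs, e. apply eqc_refl. }
apply (eventually_Forall (fun a s => forall b, In b l -> pair_agrees s (gn c) a b = true)) in Hpair.
eapply eventually_impl; [|exact (eventually_and _ _ Hl Hpair)].
intros s [Hls Hp]. unfold agrees. rewrite Hls. apply forallb_forall. intros a Ha.
apply forallb_forall. intros b Hb. auto.
Qed.

End Construction.

(** * Reductions, joins and finite ceers *)

Lemma reducible_refl R : reducible R R.
Proof. exists (fun x => x). split; [apply computable_id|easy]. Qed.

Lemma is_reduction_comp f g R S T :
  is_reduction f S T -> is_reduction g R S -> is_reduction (fun x => f (g x)) R T.
Proof.
intros [Hf Ef] [Hg Eg]. split; [now apply computable_comp|].
intros x y. now rewrite Eg, Ef.
Qed.

Lemma reducible_trans R S T : reducible R S -> reducible S T -> reducible R T.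
Proof. intros [g Hg] [f Hf]. exists (fun x => f (g x)). now apply is_reduction_comp with S. Qed.

(** The reduction sends [x] to the first [w] found with [f x] and [t w] equivalent in [E]. *)
Lemma reducible_along X T E f t :
  ceer E -> is_reduction f X E -> is_reduction t T E -> (forall x, exists w, E (f x) (t w)) ->
  reducible X T.
Proof.
intros [[_ Etrans Esym] HE] [Hf Ef] [Ht Et] Hx.
destruct (comp_enum_enumerated E HE) as [b Hb].
apply effective_computable in Hf, Ht. assert (Hbe := proj1 Hb).
(* The number searched for codes an approximation stage of [E] together with [w]. *)
destruct (effective_choice (fun k x => b (fst (of_nat k)) (f x) (t (snd (of_nat k))))) as (g & Hg
  & Eg).
{ eff. }
{ intro x. destruct (Hx x) as [w Hw]. apply Hb in Hw as [s Hs].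
  exists (to_nat (s, w)). now rewrite cancel_of_to. }
exists (fun x => snd (of_nat (g x))). split; [apply effective_computable; eff|].
assert (Hgx : forall x, E (f x) (t (snd (of_nat (g x))))) by (intro x; apply Hb; eauto).
intros x y. rewrite Ef, Et. split; intro H; eauto.
Qed.

Lemma ujoin_even R S x y : ujoin R S (2 * x) (2 * y) <-> R x y.
Proof.
split.
- intros [(x' & y' & Hx & Hy & H)|(x' & y' & Hx & Hy & H)]; [|lia].
  now replace x with x' by lia; replace y with y' by lia.
- intro H. left. now exists x, y.
Qed.

Lemma ujoin_odd R S x y : ujoin R S (2 * x + 1) (2 * y + 1) <-> S x y.
Proof.
split.
- intros [(x' & y' & Hx & Hy & H)|(x' & y' & Hx & Hy & H)]; [lia|].
  now replace x with x' by lia; replace y with y' by lia.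
- intro H. right. now exists x, y.
Qed.

Lemma ujoin_even_odd R S x y : ~ ujoin R S (2 * x) (2 * y + 1).
Proof. intros [(x' & y' & Hx & Hy & H)|(x' & y' & Hx & Hy & H)]; lia. Qed.

Lemma ujoin_odd_even R S x y : ~ ujoin R S (2 * x + 1) (2 * y).
Proof. intros [(x' & y' & Hx & Hy & H)|(x' & y' & Hx & Hy & H)]; lia. Qed.

Lemma even_odd_cases n : (exists m, n = 2 * m) \/ (exists m, n = 2 * m + 1).
Proof. exact (Nat.Even_or_Odd n). Qed.

Lemma ujoin_parity R S x y : ujoin R S x y -> Nat.even x = Nat.even y.
Proof.
intros [(x' & y' & -> & -> & _)|(x' & y' & -> & -> & _)].
- now rewrite !Nat.even_even.
- now rewrite !Nat.even_odd.
Qed.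

Lemma ujoin_equiv R S : equivalence nat R -> equivalence nat S -> equivalence nat (ujoin R S).
Proof.
intros [Rr Rt Rs] [Sr St Ss]. split.
- intro x. destruct (even_odd_cases x) as [[m ->]|[m ->]]; [apply ujoin_even|apply ujoin_odd]; auto.
- intros x y z Hxy Hyz. destruct (even_odd_cases x) as [[a ->]|[a ->]],
    (even_odd_cases y) as [[b ->]|[b ->]], (even_odd_cases z) as [[c ->]|[c ->]];
    try (now apply ujoin_even_odd in Hxy); try (now apply ujoin_odd_even in Hxy);
    try (now apply ujoin_even_odd in Hyz); try (now apply ujoin_odd_even in Hyz).
  + rewrite ujoin_even in *. eauto.
  + rewrite ujoin_odd in *. eauto.
- intros x y [(x' & y' & -> & -> & H)|(x' & y' & -> & -> & H)].
  + apply ujoin_even. auto.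
  + apply ujoin_odd. auto.
Qed.

Lemma comp_enum_ext R S : (forall x y, R x y <-> S x y) -> comp_enum R -> comp_enum S.
Proof. intros H [c Hc]. exists c. intros x y. now rewrite <- H. Qed.

Lemma ceer_ujoin R S : ceer R -> ceer S -> ceer (ujoin R S).
Proof.
intros [HR CR] [HS CS]. split; [now apply ujoin_equiv|].
destruct (comp_enum_enumerated R CR) as [b Hb], (comp_enum_enumerated S CS) as [d Hd].
assert (Hbe := proj1 Hb). assert (Hde := proj1 Hd).
set (j := fun n x y => if Bool.eqb (Nat.even x) (Nat.even y) then
  (if Nat.even x then b n (Nat.div2 x) (Nat.div2 y) else d n (Nat.div2 x) (Nat.div2 y)) else false).
apply (comp_enum_ext (fun x y => exists n, j n x y = true)).
- intros x y. unfold j. destruct (even_odd_cases x) as [[a ->]|[a ->]], (even_odd_cases y)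
  as [[c ->]|[c ->]];
    rewrite ?Nat.even_even, ?Nat.even_odd, ?Nat.div2_even, ?Nat.div2_odd'; cbn [Bool.eqb].
  + rewrite ujoin_even. symmetry. apply Hb.
  + split; [now intros []|now intros ?%ujoin_even_odd].
  + split; [now intros []|now intros ?%ujoin_odd_even].
  + rewrite ujoin_odd. symmetry. apply Hd.
- apply comp_enum_exists. unfold j.
  assert (He : effective2 Bool.eqb).
  { apply (effective_ext (fun p : bool * bool => if fst p then snd p else negb (snd p)));
      [now intros [[] []]|eff]. }
  eff.
Qed.

Lemma ceer_Id k : ceer (Id k).
Proof.
split.
- unfold Id. split; [easy|congruence|easy].
- apply (comp_enum_ext (fun x y => exists n : nat, (x mod k =? y mod k) = true)).
  + intros x y. unfold Id. split; [now intros [_ H%Nat.eqb_eq]|]. intro H. exists 0.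
    now apply Nat.eqb_eq.
  + apply (comp_enum_exists (fun _ x y => x mod k =? y mod k)). eff.
Qed.

Lemma reducible_ujoin_l R S : reducible R (ujoin R S).
Proof.
exists (fun x => 2 * x). split; [apply effective_computable; eff|]. intros. now rewrite ujoin_even.
Qed.

Lemma reducible_ujoin_r R S : reducible S (ujoin R S).
Proof.
exists (fun x => 2 * x + 1). split; [apply effective_computable; eff|]. intros.
  now rewrite ujoin_odd.
Qed.

(** * Covers *)

Definition outside_evens (E : relation nat) (x : nat) : Prop := forall a, ~ E x (2 * a).

(** The construction enters the later arguments only through these properties and its
    non-reducibility to [B]. Infinitely many classes are expressed as the possibility to avoid any
    finite list. *)
Record cover (A E : relation nat) : Prop := {
  cover_ceer : ceer E;
  cover_coding : forall a b, E (2 * a) (2 * b) <-> A a b;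
  cover_infinite : forall L, exists x, outside_evens E x /\ forall y, In y L -> ~ E x y;
  cover_large : forall f, computable f ->
    (forall L, exists x, outside_evens E (f x) /\ forall y, In y L -> ~ E (f x) y) ->
    forall j, exists x, E (f x) j }.

Lemma exists_cover A B U :
  ceer A -> ceer B -> ceer U -> ~ reducible U B -> exists E, cover A E /\ ~ reducible E B.
Proof.
intros [HA CA] [HB CB] [HU CU] HUB.
destruct (comp_enum_enumerated A CA) as [a Ha], (comp_enum_enumerated B CB) as [b Hb],
  (comp_enum_enumerated U CU) as [u Hu].
exists (limit_rel a b u). split; [constructor|].
- now apply (limit_rel_ceer A B U).
- now apply (limit_rel_coding A U).
- now apply (infinitely_many_outside A B U).
- now apply (large_range_meets_all A B U).
- now apply (limit_rel_not_reducible A B U).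
Qed.

Section Cover.
Variables (A E : relation nat).
Hypothesis HE : cover A E.

Let E_refl x : E x x.
Proof. apply (cover_ceer _ _ HE). Qed.
Let E_sym x y : E x y -> E y x.
Proof. apply (cover_ceer _ _ HE). Qed.
Let E_trans x y z : E x y -> E y z -> E x z.
Proof. apply (cover_ceer _ _ HE). Qed.

(** Inequivalence is stated for positions, so that the positions in [L] name distinct classes, as
    the residues do in [Id (length L)]. *)
Definition independent (L : list nat) : Prop :=
  (forall x, In x L -> outside_evens E x) /\
  (forall i j, i < length L -> j < length L -> E (nth i L 0) (nth j L 0) -> i = j).

Lemma independent_nil : independent [].
Proof. split; [easy|]. simpl. lia. Qed.

Lemma independent_cons x L :
  independent L -> outside_evens E x -> (forall y, In y L -> ~ E x y) -> independent (x :: L).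
Proof.
intros [HL Hd] Hx Hxy. split; [intros y [<-|Hy]; auto|].
intros [|i] [|j] Hi Hj H; simpl in *; [reflexivity| | |].
- destruct (Hxy (nth j L 0)); [apply nth_In; lia|trivial].
- destruct (Hxy (nth i L 0)); [apply nth_In; lia|auto].
- f_equal. apply Hd; [lia|lia|trivial].
Qed.

Lemma independent_exists n : exists L, independent L /\ length L = n.
Proof.
induction n as [|n (L & HL & <-)].
- exists []. split; [apply independent_nil|reflexivity].
- destruct (cover_infinite _ _ HE L) as (x & Hx & Hxy). exists (x :: L).
  split; [now apply independent_cons|reflexivity].
Qed.

(** An element of [L] is dropped if it is not outside or is equivalent to one already kept; the
    outside classes met by [L] stay represented. *)
Lemma independent_covering L : exists L', independent L' /\
  forall x, outside_evens E x -> (exists y, In y L /\ E x y) -> exists y, In y L' /\ E x y.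
Proof.
induction L as [|z L (L' & HL' & Hcov)].
- exists []. split; [apply independent_nil|]. now intros x _ (y & [] & _).
- destruct (classic (outside_evens E z /\ forall y, In y L' -> ~ E z y)) as [[Hz Hzy]|H].
  + exists (z :: L'). split; [now apply independent_cons|].
    intros x Hx (y & [<-|Hy] & Hxy).
    * exists z. split; [now left|trivial].
    * destruct (Hcov x Hx) as (y' & Hy' & Hxy'); [eauto|]. exists y'. split; [now right|trivial].
  + exists L'. split; [trivial|]. intros x Hx (y & [<-|Hy] & Hxy); [|eauto].
    apply NNPP. intro Hno. apply H. split.
    * intros a Ha. apply (Hx a). eauto.
    * intros y Hy Hzy. apply Hno. eauto.
Qed.

(** Even numbers carry [A], and odd ones run through [L] cyclically. The two facts about the range
    are what [reducible_along] asks for. *)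
Lemma join_Id_reduction L : independent L ->
  exists t, is_reduction t (join_Id A (length L)) E /\
    (forall a, exists w, t w = 2 * a) /\ (forall x, In x L -> exists w, t w = x).
Proof.
(* The empty list is separate because [join_Id A 0] is [A] itself. *)
intros [HL Hd]. destruct L as [|l L].
{ exists (fun x => 2 * x). split; [split|split].
  - apply effective_computable. eff.
  - intros x y. symmetry. apply (cover_coding _ _ HE).
  - intro a. now exists a.
  - easy. }
set (M := l :: L) in *. assert (Hk : length M <> 0) by easy.
exists (fun w => if Nat.even w then w else nth (Nat.div2 w mod length M) M 0).
assert (Hmod : forall w, w mod length M < length M) by (intro; now apply Nat.mod_upper_bound).
split; [split|split].
- apply effective_computable. eff.
- change (join_Id A (length M)) with (ujoin A (Id (length M))). intros x y.
  destruct (even_odd_cases x) as [[a ->]|[a ->]], (even_odd_cases y) as [[c ->]|[c ->]];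
    rewrite ?Nat.even_even, ?Nat.even_odd, ?Nat.div2_odd'.
  + rewrite ujoin_even. symmetry. apply (cover_coding _ _ HE).
  + split; [now intros ?%ujoin_even_odd|]. intro H. exfalso.
    apply (HL (nth (c mod length M) M 0)) with a; [now apply nth_In|auto].
  + split; [now intros ?%ujoin_odd_even|]. intro H. exfalso.
    now apply (HL (nth (a mod length M) M 0)) with c; [apply nth_In|].
  + rewrite ujoin_odd. unfold Id. split; [intros ->; apply E_refl|]. now apply Hd.
- intro a. exists (2 * a). now rewrite Nat.even_even.
- intros x Hx. destruct (In_nth M x 0 Hx) as (i & Hi & <-). exists (2 * i + 1).
  rewrite Nat.even_odd, Nat.div2_odd', Nat.mod_small; trivial.
Qed.

Lemma join_Id_below_cover n : reducible (join_Id A n) E.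
Proof.
destruct (independent_exists n) as (L & HL & <-). destruct (join_Id_reduction L HL) as (t & Ht & _).
now exists t.
Qed.

(** If the range does not meet infinitely many outside classes, those it meets are represented by a
    finite independent list. With the even classes these cover the range, and the reduction passes
    through [join_Id]. *)
Lemma onto_or_below X f : is_reduction f X E ->
  (forall j, exists x, E (f x) j) \/ exists k, reducible X (join_Id A k).
Proof.
intro Hf.
destruct (classic (forall L, exists x, outside_evens E (f x) /\ forall y, In y L
  -> ~ E (f x) y)) as [H|H].
- left. apply (cover_large _ _ HE); [apply Hf|trivial].
- right. apply not_all_ex_not in H as [L HL].
  destruct (independent_covering L) as (L' & HL' & Hcov).
  destruct (join_Id_reduction L' HL') as (t & Ht & Hta & HtL). exists (length L').
  apply (reducible_along X _ E f t); trivial; [apply HE|]. intro x.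
  destruct (classic (outside_evens E (f x))) as [Hx|Hx].
  + destruct (Hcov (f x) Hx) as (y & Hy & Hxy).
    * apply NNPP. intro Hno. apply HL. exists x. split; [trivial|]. intros y Hy Hxy. apply Hno.
      eauto.
    * destruct (HtL y Hy) as [w <-]. now exists w.
  + apply not_all_ex_not in Hx as [a Ha]. destruct (Hta a) as [w Hw]. exists w. rewrite Hw.
    now apply NNPP.
Qed.

(** A reduction that meets all classes can be inverted by search, which strictness forbids. *)
Lemma strictly_below_cover X : strictly_reducible X E -> exists k, reducible X (join_Id A k).
Proof.
intros [[f Hf] HEX]. destruct (onto_or_below X f Hf) as [Honto|]; [|trivial].
destruct HEX. apply (reducible_along E X E (fun x => x) f); trivial.
- apply HE.
- split; [apply computable_id|easy].
- intro x. destruct (Honto x) as [w Hw]. eauto.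
Qed.

(** Apply [cover_large] to the function that fixes the numbers with [b x = v] and sends all others
    to one such number [x0]: its range meets every class without leaving the closed set. *)
Lemma closed_of_large b v : effective b -> (forall x y, E x y -> b x = b y) ->
  (forall L, exists x, b x = v /\ outside_evens E x /\ forall y, In y L -> ~ E x y) ->
  forall x, b x = v.
Proof.
intros Hb Hcl Hlarge. destruct (Hlarge []) as (x0 & Hx0 & _).
assert (Hbv : forall x, b (if eqc (b x) v then x else x0) = v).
{ intro x. destruct (eqc (b x) v) eqn:e; [now rewrite eqc_true in e|trivial]. }
intro j. destruct (cover_large _ _ HE (fun x => if eqc (b x) v then x else x0)) with (j := j)
  as [x Hx].
- apply effective_computable. eff.
- intro L. destruct (Hlarge L) as (x & Hv & Hx). exists x. now rewrite Hv, eqc_refl.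
- rewrite <- (Hcl _ _ Hx). apply Hbv.
Qed.

(** A closed set or its complement meets infinitely many outside classes. *)
Lemma closed_trivial b : effective b -> (forall x y, E x y -> b x = b y) ->
  (forall x, b x = true) \/ (forall x, b x = false).
Proof.
intros Hb Hcl.
destruct (classic (forall L, exists x, b x = true /\ outside_evens E x /\ forall y, In y L
  -> ~ E x y)) as [H|H].
- left. now apply closed_of_large.
- right. apply not_all_ex_not in H as [L0 HL0]. apply closed_of_large; trivial. intro L.
  (* Avoiding [L0] forces the value [false]; avoiding [L] gives what is asked. *)
  destruct (cover_infinite _ _ HE (L0 ++ L)) as (x & Hx & HxL). exists x. split; [|split;
    [trivial|]].
  + apply Bool.not_true_is_false. intro e. apply HL0. exists x. split; [trivial|split; [trivial|]].
    intros y Hy. apply HxL, in_or_app. now left.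
  + intros y Hy. apply HxL, in_or_app. now right.
Qed.

(** The numbers that [f] sends to the left summand form a decidable closed set. *)
Lemma into_one_side f R S : computable f -> (forall x y, E x y -> ujoin R S (f x) (f y)) ->
  (forall x, f x = 2 * Nat.div2 (f x)) \/ (forall x, f x = 2 * Nat.div2 (f x) + 1).
Proof.
intros Hf Hfe. apply effective_computable in Hf.
destruct (closed_trivial (fun x => Nat.even (f x))) as [H|H].
- eff.
- intros x y Hxy. now apply (ujoin_parity R S), Hfe.
- left. intro x. specialize (H x). destruct (even_odd_cases (f x)) as [[m e]|[m e]]; rewrite e in *.
  + now rewrite Nat.div2_even.
  + now rewrite Nat.even_odd in H.
- right. intro x. specialize (H x). destruct (even_odd_cases (f x)) as [[m e]|[m e]];
  rewrite e in *.
  + now rewrite Nat.even_even in H.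
  + now rewrite Nat.div2_odd'.
Qed.

Lemma cover_below_ujoin R S : reducible E (ujoin R S) -> reducible E R \/ reducible E S.
Proof.
intros (f & Hf & Ef).
assert (Hg : computable (fun x => Nat.div2 (f x))).
{ apply effective_computable. apply effective_computable in Hf. eff. }
destruct (into_one_side f R S Hf) as [H|H].
- intros x y. apply Ef.
- left. exists (fun x => Nat.div2 (f x)). split; [trivial|]. intros x y.
  rewrite Ef, (H x), (H y), !Nat.div2_even. apply ujoin_even.
- right. exists (fun x => Nat.div2 (f x)). split; [trivial|]. intros x y.
  rewrite Ef, (H x), (H y), !Nat.div2_odd'. apply ujoin_odd.
Qed.

(** By induction on [n], finitely many classes contain all numbers with residue below [n]; for
    [n = k] this contradicts the infinitely many classes. *)
Lemma cover_not_below_Id k : k <> 0 -> ~ reducible E (Id k).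
Proof.
intros Hk (f & _ & Ef).
assert (H : forall n, exists L, forall x, f x mod k < n -> exists y, In y L /\ E x y).
{ induction n as [|n [L HL]]; [exists []; lia|].
  destruct (classic (exists z, f z mod k = n)) as [[z Hz]|Hno].
  - exists (z :: L). intros x Hx. destruct (Nat.eq_dec (f x mod k) n) as [e|].
    + exists z. split; [now left|]. apply Ef. unfold Id. congruence.
    + destruct (HL x) as (y & Hy & Hxy); [lia|]. exists y. split; [now right|trivial].
  - exists L. intros x Hx. apply HL. assert (f x mod k <> n) by eauto. lia. }
destruct (H k) as [L HL]. destruct (cover_infinite _ _ HE L) as (x & _ & Hx).
destruct (HL x) as (y & Hy & Hxy); [now apply Nat.mod_upper_bound|]. now apply (Hx y).
Qed.

(** * Self-fullness of covers *)

Hypothesis E_A : ~ reducible E A.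

Lemma cover_not_below_join_Id k : ~ reducible E (join_Id A k).
Proof.
destruct k as [|k]; [exact E_A|]. intros [H|H]%cover_below_ujoin; [easy|].
now apply (cover_not_below_Id (S k)) in H.
Qed.

Lemma cover_self_full : self_full E.
Proof.
intros f Hf. destruct (onto_or_below E f Hf) as [H|[k H]]; [exact H|].
now destruct (cover_not_below_join_Id k).
Qed.

(* If a self-reduction [f] of the join sends the part [E] into the part [E], then it is onto
   on both parts. Otherwise it sends [E] into [Y], and the first return map [g] of [f] to the
   part [Y] is a self-reduction of [Y], which makes [f] onto. *)
Lemma cover_hereditarily_self_full : hereditarily_self_full E.
Proof.
intros Y _ HY f [Hf Ef].
assert (Hf' := proj2 (effective_computable f) Hf).
assert (Hside : (forall x, f (2 * x) = 2 * Nat.div2 (f (2 * x))) \/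
  (forall x, f (2 * x) = 2 * Nat.div2 (f (2 * x)) + 1)).
{ apply (into_one_side (fun x => f (2 * x)) E Y).
  - apply effective_computable. eff.
  - intros x y Hxy. now apply (proj1 (Ef _ _)), ujoin_even. }
destruct Hside as [Hev|Hod].
- assert (HontoE : forall y, exists x, ujoin E Y (f (2 * x)) (2 * y)).
  { intro y. destruct (cover_self_full (fun x => Nat.div2 (f (2 * x)))) with (y := y) as [x Hx].
    - split; [apply effective_computable; eff|]. intros x z.
      now rewrite <- (ujoin_even E Y (Nat.div2 _)), <- Hev, <- Hev, <- Ef, ujoin_even.
    - exists x. rewrite Hev. now apply ujoin_even. }
  (* The even numbers already reach every class of [E], so an odd number sent there would be
     equivalent to an even one. *)
  assert (Hodd : forall y, f (2 * y + 1) = 2 * Nat.div2 (f (2 * y + 1)) + 1).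
  { intro y. destruct (even_odd_cases (f (2 * y + 1))) as [[m e]|[m e]]; rewrite e.
    - destruct (HontoE m) as [x Hx]. rewrite <- e, <- Ef in Hx. now apply ujoin_even_odd in Hx.
    - now rewrite Nat.div2_odd'. }
  intro z. destruct (even_odd_cases z) as [[y ->]|[y ->]].
  + destruct (HontoE y) as [x Hx]. eauto.
  + destruct (HY (fun x => Nat.div2 (f (2 * x + 1)))) with (y := y) as [x Hx].
    * split; [apply effective_computable; eff|]. intros x x'.
      now rewrite <- (ujoin_odd E Y (Nat.div2 _)), <- Hodd, <- Hodd, <- Ef, ujoin_odd.
    * exists (2 * x + 1). rewrite Hodd. now apply ujoin_odd.
(* An element of [Y] sent into [E] returns to [Y] under one more application of [f]. *)
- set (g := fun y => if Nat.even (f (2 * y + 1)) then f (f (2 * y + 1)) else f (2 * y + 1)).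
  assert (Hcases : forall y,
    (exists a, f (2 * y + 1) = 2 * a /\ g y = f (2 * a)) \/
    (exists a, f (2 * y + 1) = 2 * a + 1 /\ g y = f (2 * y + 1))).
  { intro y. unfold g. destruct (even_odd_cases (f (2 * y + 1))) as [[a e]|[a e]].
    - left. exists a. now rewrite e, Nat.even_even.
    - right. exists a. now rewrite e, Nat.even_odd. }
  assert (Hg : forall y, g y = 2 * Nat.div2 (g y) + 1).
  { intro y. destruct (Hcases y) as [(a & e & ->)|(a & e & ->)]; [apply Hod|].
    now rewrite e, Nat.div2_odd'. }
  assert (HgY : is_reduction (fun y => Nat.div2 (g y)) Y Y).
  { split; [apply effective_computable; unfold g; eff|]. intros y y'.
    rewrite <- (ujoin_odd E Y (Nat.div2 (g y))), <- Hg, <- Hg, <- (ujoin_odd E Y y).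
    destruct (Hcases y) as [(a & e & ->)|(a & e & ->)], (Hcases y') as [(a' & e' &
      ->)|(a' & e' & ->)].
    - now rewrite <- Ef, <- e, <- e', <- Ef.
    (* If only one of the two elements passes through [E], both sides are false by parity. *)
    - rewrite Ef, <- (Ef (2 * a)), e, e'. split; intro H; exfalso.
      + now apply ujoin_even_odd in H.
      + now apply ujoin_even_odd in H.
    - rewrite Ef, <- (Ef _ (2 * a')), e, e'. split; intro H; exfalso.
      + now apply ujoin_odd_even in H.
      + now apply ujoin_odd_even in H.
    - apply Ef. }
  assert (Honto : forall y, exists x, ujoin E Y (g x) (2 * y + 1)).
  { intro y. destruct (HY _ HgY y) as [x Hx]. exists x. rewrite Hg. now apply ujoin_odd. }
  intro z. destruct (even_odd_cases z) as [[y ->]|[y ->]].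
  (* The element [f (2 * y)] lies in [Y], hence is met by [g]. Cancelling one [f] either yields a
     preimage of [2 * y] or relates elements of different parity. *)
  + destruct (Honto (Nat.div2 (f (2 * y)))) as [x Hx]. rewrite <- Hod in Hx.
    destruct (Hcases x) as [(a & e & e')|(a & e & e')]; rewrite e', <- Ef in Hx.
    * exists (2 * x + 1). now rewrite e.
    * now apply ujoin_odd_even in Hx.
  + destruct (Honto y) as [x Hx]. unfold g in Hx. destruct (Nat.even _); eauto.
Qed.

End Cover.

(** * Non-universality, and the sequence of ceers *)

(** A universal [E] would bound its join with a one-class ceer; restricted to [E], the reduction
    would miss the class of the extra point. *)
Lemma self_full_not_universal E : ceer E -> self_full E -> ~ universal E.
Proof.
intros HE Hsf [_ Huniv].
destruct (Huniv (ujoin E (Id 1))) as (f & Hf & Ef); [apply ceer_ujoin; [trivial|apply ceer_Id]|].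
destruct (Hsf (fun x => f (2 * x))) with (y := f (2 * 0 + 1)) as [x Hx].
- split.
  + apply effective_computable. apply effective_computable in Hf. eff.
  + intros x y. now rewrite <- Ef, ujoin_even.
- apply Ef in Hx. now apply ujoin_even_odd in Hx.
Qed.

Lemma not_universal_witness R : ceer R -> ~ universal R -> exists U, ceer U /\ ~ reducible U R.
Proof.
intros HR Hnu. apply NNPP. intro H. apply Hnu. split; [trivial|]. intros U HU.
apply NNPP. intro HUR. apply H. eauto.
Qed.

(** Choose [R'] and [S'] not below [R] and [S]. A cover of their join lies below no join of [R] and
    [S], since it would lie below one summand and carry [R'] or [S'] along. *)
Lemma ujoin_not_universal R S :
  ceer R -> ceer S -> ~ universal R -> ~ universal S -> ~ universal (ujoin R S).
Proof.
intros HR HS HnR HnS [_ Huniv].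
destruct (not_universal_witness R HR HnR) as (R' & HR' & HRR).
destruct (not_universal_witness S HS HnS) as (S' & HS' & HSS).
(* Any instance of non-reducibility serves to obtain a cover; [Id 2] and [Id 1] provide one. *)
destruct (exists_cover (ujoin R' S') (Id 1) (Id 2)) as (E & HE & _).
{ now apply ceer_ujoin. }
{ apply ceer_Id. }
{ apply ceer_Id. }
{ intros (f & _ & Hf). assert (H : Id 2 0 1) by (apply Hf; unfold Id; now rewrite !Nat.mod_1_r).
  discriminate H. }
assert (Hbelow := join_Id_below_cover _ _ HE 0). cbn [join_Id] in Hbelow.
destruct (cover_below_ujoin _ _ HE R S (Huniv E (cover_ceer _ _ HE))) as [H|H].
- apply HRR. eapply reducible_trans; [apply (reducible_ujoin_l R' S')|].
  now apply reducible_trans with E.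
- apply HSS. eapply reducible_trans; [apply (reducible_ujoin_r R' S')|].
  now apply reducible_trans with E.
Qed.

Theorem mainTheorem5 (A : relation nat) (hA : ceer A) (hnu : ~ universal A) :
  exists E : nat -> relation nat,
    (forall l, ceer (E l) /\ hereditarily_self_full (E l)) /\
    (forall l m, l <> m -> incomparable (E l) (E m)) /\
    (forall n l,
        reducible (join_Id A n) (E l) /\
        forall X, ceer X -> strictly_reducible X (E l) ->
          exists k, reducible X (join_Id A k)).
Proof.
(* The hypotheses on [B] stand under the existential, so that one choice function is defined on all
   relations, with [A] as default value. *)
assert (Hpick : forall B, exists E, ceer B -> ~ universal B -> cover A E /\ ~ reducible E B).
{ intro B. destruct (classic (ceer B /\ ~ universal B)) as [[HB HnB]|H].
  - destruct (not_universal_witness B HB HnB) as (U & HU & HUB).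
    destruct (exists_cover A B U hA HB HU HUB) as [E HE]. now exists E.
  - exists A. intros HB HnB. now destruct H. }
pose (pick := fun B => proj1_sig (constructive_indefinite_description _ (Hpick B))).
assert (pick_spec : forall B, ceer B -> ~ universal B -> cover A (pick B)
  /\ ~ reducible (pick B) B).
{ intro B. exact (proj2_sig (constructive_indefinite_description _ (Hpick B))). }
(* [bound l] is the iterated join of [A] with the ceers picked before [l]; the ceer of index [l] is
   picked against it. *)
pose (bound := nat_rect (fun _ => relation nat) A (fun _ B => ujoin B (pick B))).
assert (Hbound : forall l, ceer (bound l) /\ ~ universal (bound l) /\ reducible A (bound l)).
{ induction l as [|l (Hc & Hu & Hr)]; [split; [|split]; trivial; apply reducible_refl|].
  destruct (pick_spec _ Hc Hu) as [HE HEB]. cbn [bound nat_rect]. fold (bound l).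
  split; [|split].
  - apply ceer_ujoin; [trivial|apply HE].
  - apply ujoin_not_universal; trivial; [apply HE|].
    apply self_full_not_universal; [apply HE|]. apply (cover_self_full A); [trivial|].
    intro H. apply HEB. now apply reducible_trans with A.
  - eapply reducible_trans; [exact Hr|apply reducible_ujoin_l]. }
assert (HE : forall l, cover A (pick (bound l))) by (intro l; apply pick_spec; apply Hbound).
assert (HnB : forall l, ~ reducible (pick (bound l)) (bound l)) by (intro l; apply pick_spec;
  apply Hbound).
assert (HnA : forall l, ~ reducible (pick (bound l)) A).
{ intros l H. apply (HnB l). apply reducible_trans with A; [trivial|apply Hbound]. }
assert (Hlt : forall m l, m < l -> reducible (pick (bound m)) (bound l)).
{ intros m l. induction 1 as [|l _ IH].
  - apply (reducible_ujoin_r (bound m) (pick (bound m))).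
  - eapply reducible_trans; [exact IH|]. apply (reducible_ujoin_l (bound l) (pick (bound l))). }
assert (Hinc : forall m l, m < l -> incomparable (pick (bound m)) (pick (bound l))).
{ intros m l Hml.
  assert (Hlm : ~ reducible (pick (bound l)) (pick (bound m))).
  { intro H. apply (HnB l). eapply reducible_trans; [exact H|auto]. }
  split; [|exact Hlm]. intro H.
  destruct (strictly_below_cover A _ (HE l) (pick (bound m))) as [k Hk]; [now split|].
  now apply (cover_not_below_join_Id A _ (HE m) (HnA m) k). }
exists (fun l => pick (bound l)). split; [|split].
- intro l. split; [apply HE|]. now apply (cover_hereditarily_self_full A).
- intros l m Hlm. destruct (Nat.lt_trichotomy l m) as [H|[H|H]]; [auto|easy|].
  destruct (Hinc m l H). now split.
- intros n l. split; [now apply join_Id_below_cover|].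
  intros X _ HX. now apply (strictly_below_cover A _ (HE l)).
Qed.
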